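(* Let $f_1, f_2, \ldots, f_n$ be (possibly multivariate) polynomials over $\mathbb{C}$, not all similar, such that $$f_1 + f_2 + \cdots + f_n = 0.$$ Assume furthermore that for all $1 \le i_1 < i_2 < \cdots < i_s \le n$, $$f_{i_1} + f_{i_2} + \cdots + f_{i_s} = 0 \Longrightarrow \deg \gcd\{f_{i_1}, f_{i_2}, \ldots, f_{i_s}\} \le \deg f_n.$$ Let $d$ be the dimension of the vector space over $\mathbb{C}$ spanned by $f_1,\ldots,f_n$ and $k$ the number of constant $f_i$'s. Then $$\max_{1 \le m \le n-1} \deg f_m - \deg f_n \le (d'-1)\left(r(f_1) + r(f_2) + \cdots + r(f_{n-1}) - \frac{d'}{2}\right)$$ for all integers $d'$ with $d \le d' \le n-k$. Furthermore, equality in this inequality is only possible if $\gcd\{f_1, f_2, \ldots, f_n\} = 1$.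
   Context: Degrees are total degrees. Two polynomials $f_1, f_2$ are similar if $f_2 = \lambda f_1$ for some $\lambda \in \mathbb{C}^*$. For a nonzero polynomial $p$ over $\mathbb{C}$ with factorization $p = c\,p_1^{e_1}\cdots p_s^{e_s}$ into pairwise non-associate irreducible polynomials with $e_i\ge 1$, $c\in\mathbb{C}^*$, let $\mathfrak{r}(p) = p_1\cdots p_s$ and $r(p) = \deg \mathfrak{r}(p)$. *)

(* Defs.v *)
From HB Require Import structures.
From mathcomp Require Import all_boot all_order all_algebra.
From mathcomp Require Import reals.
From mathcomp Require Import complex.
From mathcomp Require Import mpoly.
From Stdlib Require Import ClassicalEpsilon.

Set Implicit Arguments.
Unset Strict Implicit.
Unset Printing Implicit Defensive.

Import Order.TTheory GRing.Theory Num.Theory.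
Local Open Scope ring_scope.

Section Divisibility.
Variable A : idomainType.
Implicit Types a b g h p : A.

Definition divides a b : Prop := exists c, b = c * a.

Definition associated a b : Prop := exists2 u, u \is a GRing.unit & b = u * a.

Definition irreducible_elt p : Prop :=
  [/\ p != 0, p \isn't a GRing.unit
    & forall a b, p = a * b -> a \is a GRing.unit \/ b \is a GRing.unit].

(* Gcds are only determined up to units, so "g is a gcd" is a relation; a gcd
   "equal to 1" means that 1 is one of them. *)
Definition is_gcd (I : finType) (f : I -> A) (S : {set I}) g : Prop :=
  (forall i, i \in S -> divides g (f i)) /\
  (forall h, (forall i, i \in S -> divides h (f i)) -> divides h g).

End Divisibility.

Section SpanDimension.
Variables (F : fieldType) (V : lmodType F).

Definition in_span (n : nat) (f : 'I_n -> V) (x : V) : Prop :=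
  exists a : 'I_n -> F, x = \sum_i a i *: f i.

Definition lin_indep (n : nat) (b : 'I_n -> V) : Prop :=
  forall a : 'I_n -> F, \sum_i a i *: b i = 0 -> forall i, a i = 0.

(* V need not be finite dimensional, so mathcomp's \dim does not apply; the
   dimension of the span of f is the number of elements of a basis of it. *)
Definition span_dim (n : nat) (f : 'I_n -> V) (d : nat) : Prop :=
  exists b : 'I_d -> V,
    [/\ forall j, in_span f (b j), lin_indep b & forall i, in_span b (f i)].

End SpanDimension.

Section Polynomials.
Variables (F : fieldType) (v : nat).
Implicit Types p q : {mpoly F[v]}.

(* msize is one more than the total degree, and is 0 at 0; hence tdeg 0 = 0. *)
Definition tdeg p : nat := (msize p).-1.

Definition is_const p : bool := p == (p@_0%MM)%:MP_[v].

Definition poly_similar p q : Prop := exists2 c : F, c != 0 & q = c *: p.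

Definition is_radical p q : Prop :=
  exists (s : nat) (c : F) (P : 'I_s -> {mpoly F[v]}) (e : 'I_s -> nat),
    c != 0 /\
    (forall i, irreducible_elt (P i)) /\
    (forall i j, i != j -> ~ associated (P i) (P j)) /\
    (forall i, (0 < e i)%N) /\
    p = c *: \prod_i P i ^+ e i /\
    q = \prod_i P i.

(* Determined up to a nonzero constant factor; only meaningful for p <> 0. *)
Definition radical p : {mpoly F[v]} := epsilon (inhabits 0) (is_radical p).

Definition rdeg p : nat := tdeg (radical p).

End Polynomials.

(* Main.v *)
Require Import Defs.
From HB Require Import structures.
From mathcomp Require Import all_boot all_order all_fingroup all_algebra.
From mathcomp Require Import reals.
From mathcomp Require Import complex.
From mathcomp Require Import mpoly.
From mathcomp Require Import zify lra.
From Stdlib Require Import Classical ClassicalEpsilon.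

Set Implicit Arguments.
Unset Strict Implicit.
Unset Printing Implicit Defensive.

Import Order.TTheory GRing.Theory Num.Theory.
Local Open Scope ring_scope.

(* A line x = a + t b in general position keeps all the degrees, all the
   non-vanishing subsums and all the degrees of gcds (Gauss's lemma and Bezout
   over the coordinate ring), and the distinct roots of a restricted polynomial
   are roots of its restricted radical. This reduces the inequality to C[t].

   For univariate F_i, all Wronskians of bases of a span are proportional. Let
   W be one for a family M of dimension e. At each root x pick a basis B_x of M
   of large multiplicity, and at infinity a basis of small degree: then
   ord_x W >= sum_(B_x) ord_x F_i - (e - 1) #{i in B_x | F_i(x) = 0}, while
   deg W <= sum_(B_oo) deg F_i - e (e - 1) / 2. The bases are built by growing
   M: as long as the span of M meets the span of the other members, a minimal
   J with span M /\ span J <> 0 (an "ear") is added to M and all of J but one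
   element, chosen locally, is added to each basis. When no ear is left, M has
   sum 0. Starting with F_n, this gives the bound for all members of M; any
   other F_m is reached by growing {m} inside the complement of M, where the
   hypothesis on gcds applies.

   The bound is applied to h = f / gcd(f) restricted to the line: a root of the
   gcd then is a root of all f_i but not of all h_i, whence strictness. *)

(** * Factorial rings and Gauss's lemma *)

Section FactorialRings.
Variable A : idomainType.
Implicit Types a b g h p u : A.

Definition prime_elt p : Prop :=
  [/\ p != 0, p \isn't a GRing.unit
    & forall a b, divides p (a * b) -> divides p a \/ divides p b].

(** Factors are prime rather than merely irreducible, so that existence alone forces uniqueness. *)
Definition factorial_ring : Prop :=
  forall a, a != 0 -> exists u s,
    [/\ u \is a GRing.unit, forall p, p \in s -> prime_elt p
      & a = u * \prod_(p <- s) p].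

Lemma dividesxx a : divides a a.
Proof. by exists 1; rewrite mul1r. Qed.

Lemma divides_trans b a c : divides a b -> divides b c -> divides a c.
Proof. by case=> x -> [y ->]; exists (y * x); rewrite mulrA. Qed.

Lemma divides_mull a b c : divides a b -> divides a (c * b).
Proof. by case=> x ->; exists (c * x); rewrite mulrA. Qed.

Lemma divides_mulr a b c : divides a b -> divides a (b * c).
Proof. by rewrite mulrC; apply: divides_mull. Qed.

Lemma dividesD a b c : divides a b -> divides a c -> divides a (b + c).
Proof. by case=> x -> [y ->]; exists (x + y); rewrite mulrDl. Qed.

Lemma dividesN a b : divides a b -> divides a (- b).
Proof. by case=> x ->; exists (- x); rewrite mulNr. Qed.

Lemma dividesB a b c : divides a b -> divides a c -> divides a (b - c).
Proof. by move=> ab ac; apply: dividesD ab (dividesN ac). Qed.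

Lemma divides0 a : divides a 0.
Proof. by exists 0; rewrite mul0r. Qed.

Lemma divides_unit a u : u \is a GRing.unit -> divides a u -> a \is a GRing.unit.
Proof. by move=> uU [c eu]; move: uU; rewrite eu unitrM => /andP[]. Qed.

Lemma prime_divides_prod p (s : seq A) :
  prime_elt p -> divides p (\prod_(q <- s) q) ->
  exists2 q, q \in s & divides p q.
Proof.
move=> [p0 pU pP]; elim: s => [|q s IHs].
  by rewrite big_nil => /(divides_unit (unitr1 _)); rewrite (negPf pU).
rewrite big_cons => /pP[pq|/IHs[r rs pr]]; first by exists q; rewrite ?mem_head.
by exists r; rewrite // in_cons rs orbT.
Qed.

Lemma prime_irreducible p : prime_elt p -> irreducible_elt p.
Proof.
case=> p0 pU pP; split=> // a b pab.
have unit_cofactor x y : p = x * y -> divides p x -> y \is a GRing.unit.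
  move=> pxy [c xcp]; have /eqP : (1 - c * y) * p = 0.
    by rewrite mulrBl mul1r {1}pxy xcp mulrAC subrr.
  rewrite mulf_eq0 (negPf p0) orbF subr_eq0 => /eqP cy1.
  by apply/unitrPr; exists c; rewrite mulrC -cy1.
have: divides p (a * b) by rewrite -pab; apply: dividesxx.
case/pP=> [/(unit_cofactor _ _ pab)|]; first by right.
by rewrite mulrC in pab => /(unit_cofactor _ _ pab); left.
Qed.

Lemma prime_divides_prime p q : prime_elt p -> prime_elt q -> divides p q ->
  exists2 u, u \is a GRing.unit & q = u * p.
Proof.
move=> [p0 pU _] /prime_irreducible [q0 qU qirr] [c qcp].
by case: (qirr c p qcp) => [cU|]; [exists c | rewrite (negPf pU)].
Qed.

(** [p] divides some member of [s], hence is associated to it; that member is removed and the unit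
    absorbed. The drop in length drives the inductions on the number of prime factors. *)
Lemma divide_factored p u s b : prime_elt p -> u \is a GRing.unit ->
    (forall q, q \in s -> prime_elt q) -> p * b = u * \prod_(q <- s) q ->
  exists u' s', [/\ u' \is a GRing.unit, forall q, q \in s' -> prime_elt q,
    b = u' * \prod_(q <- s') q & (size s').+1 = size s].
Proof.
move=> pP uU sP def_pb; have [p0 pU pdvd] := pP.
have: divides p (u * \prod_(q <- s) q).
  by rewrite -def_pb; apply: divides_mulr; apply: dividesxx.
case/pdvd=> [/(divides_unit uU)|]; first by rewrite (negPf pU).
case/(prime_divides_prod pP)=> q qs pq.
have [w wU qwp] := prime_divides_prime pP (sP q qs) pq.
exists (u * w), (rem q s); split.
- by rewrite unitrM uU.
- by move=> r /mem_rem; apply: sP.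
- apply: (mulfI p0); rewrite def_pb (perm_big _ (perm_to_rem qs)) big_cons /=.
  by rewrite qwp [w * p]mulrC !mulrA [u * p]mulrC.
- by rewrite size_rem // prednK //; case: (s) qs.
Qed.

End FactorialRings.

Section GaussLemma.
Variable A : idomainType.
Hypothesis factA : factorial_ring A.
Implicit Types (f g h : {poly A}) (c p u : A).

(** Stated through prime constants, which avoids choosing a content. *)
Definition primitive f := forall p, prime_elt p -> ~ divides p%:P f.

(** Gauss's lemma. [p] divides the product of the leading coefficients, hence one of them; that
    leading term is a multiple of [p] and is stripped, by induction on the sum of the sizes. *)
Lemma prime_polyC p : prime_elt p -> prime_elt p%:P.
Proof.
case=> p0 pU pP; split=> [||f g]; first by rewrite polyC_eq0.
  by rewrite poly_unitE coefC eqxx (negPf pU) andbF.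
have [n] := ubnP (size f + size g); elim: n => // n IHn in f g *.
rewrite ltnS => len pfg.
have [->|f0] := eqVneq f 0; first by left; apply: divides0.
have [->|g0] := eqVneq g 0; first by right; apply: divides0.
have strip h : h != 0 -> divides p (lead_coef h) ->
  exists h1 h2, [/\ h = h1 + h2, divides p%:P h1 & (size h2 < size h)%N].
  move=> h0 [c lc]; exists ((c%:P * 'X^((size h).-1)) * p%:P).
  exists (h - (c%:P * 'X^((size h).-1)) * p%:P); split.
  - by rewrite addrC subrK.
  - by eexists.
  rewrite mulrAC -polyCM -lc.
  have sz : (0 < size h)%N by rewrite size_poly_gt0.
  rewrite -(prednK sz) ltnS; apply/leq_sizeP => j.
  rewrite leq_eqVlt coefB coefCM coefXn => /orP[/eqP<-|ltj].
    by rewrite eqxx mulr1 subrr.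
  rewrite gtn_eqF // mulr0 subr0 nth_default // -(prednK sz) //.
have: divides p (lead_coef f * lead_coef g).
  rewrite -lead_coefM; case: pfg => q ->; exists (lead_coef q).
  by rewrite lead_coefM lead_coefC.
case/pP=> [/(strip f f0)|/(strip g g0)] [h1 [h2 [def ph1 szh]]].
- have: divides p%:P (h2 * g).
    have -> : h2 * g = f * g - h1 * g by rewrite def mulrDl addrC addKr.
    by apply: dividesB => //; apply: divides_mulr.
  case/IHn => [|ph2|pg]; last by right.
    by apply: leq_trans len; rewrite ltn_add2r.
  by left; rewrite def; apply: dividesD.
- have: divides p%:P (f * h2).
    have -> : f * h2 = f * g - f * h1 by rewrite def mulrDr addrC addKr.
    by apply: dividesB => //; apply: divides_mull.
  case/IHn => [|pf|ph2]; [|by left|].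
    by apply: leq_trans len; rewrite ltn_add2l.
  by right; rewrite def; apply: dividesD.
Qed.

(** Here [%|] is divisibility up to a nonzero constant [c]. The primes of [c] are cancelled one at a
    time: each divides [q] by Gauss's lemma, as it cannot divide the primitive [f]. *)
Lemma primitive_dvdp f g : primitive f -> f %| g -> divides f g.
Proof.
move=> primf /Pdiv.WeakIdomain.dvdpP [[c q] /= c0 def].
have [u [s [uU sP defc]]] := factA c0; rewrite {c c0}defc in def.
elim: s => [|p s IHs] in q sP def *.
  exists (u^-1 *: q); rewrite -scalerAl -def big_nil mulr1 scalerA.
  by rewrite mulVr // scale1r.
have pP : prime_elt p by apply: sP; rewrite mem_head.
have: divides p%:P (q * f).
  rewrite -def big_cons mulrCA -scalerA.
  by exists ((u * \prod_(j <- s) j) *: g); rewrite [RHS]mulrC mul_polyC.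
have [p0 _ _] := pP; have [_ _ /[apply]] := prime_polyC pP.
case=> [[q' def_q]|/(primf _ pP)//].
apply: IHs (q') _ _ => [r rs|]; first by apply: sP; rewrite in_cons rs orbT.
have /mulfI : p%:P != 0 by rewrite polyC_eq0.
apply; rewrite mulrA [_ * q']mulrC -def_q -def mul_polyC scalerA big_cons.
by rewrite mulrCA.
Qed.

(** Each constant prime split off uses up one prime factor of the leading coefficient, so the
    process stops. *)
Lemma primitive_part f : f != 0 ->
  exists c f0, [/\ c != 0, primitive f0 & f = c *: f0].
Proof.
move=> f0; have lc0 : lead_coef f != 0 by rewrite lead_coef_eq0.
have [u [s [uU sP]]] := factA lc0.
have [n] := ubnP (size s); elim: n => // n IHn in f f0 u s uU sP lc0 *.
rewrite ltnS => len lc.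
case: (classic (primitive f)) => [?|/not_all_ex_not[p]].
  by exists 1, f; rewrite oner_eq0 scale1r.
move=> npf; have [pP /NNPP[q defq]] := imply_to_and _ _ npf.
have q0 : q != 0 by apply: contraNneq f0 => q0; rewrite defq q0 mul0r.
have [p0 _ _] := pP.
have : p * lead_coef q = u * \prod_(r <- s) r.
  by rewrite -lc defq lead_coefM lead_coefC mulrC.
case/(divide_factored pP uU sP)=> u' [s' [u'U s'P lcq szs]].
have lq0 : lead_coef q != 0 by rewrite lead_coef_eq0.
have [|c [g [c0 gP defg]]] := IHn q q0 u' s' u'U s'P lq0 _ lcq.
  by rewrite szs.
exists (p * c), g; split => //; first by rewrite mulf_neq0.
by rewrite defq defg mulrC mul_polyC scalerA.
Qed.

(** If the primitive part [h] has a proper divisor of positive degree, up to constants, recurse on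
    the primitive part of that divisor. Otherwise [h] is prime: [gcdp h a] is constant or as large
    as [h], so [h] divides [b] or [a], and [primitive_dvdp] removes the constants. *)
Lemma exists_prime_factor f : (1 < size f)%N ->
  exists h, [/\ prime_elt h, (1 < size h)%N & divides h f].
Proof.
have [n] := ubnP (size f); elim: n => // n IHn in f *.
rewrite ltnS => len sz1.
have f0 : f != 0 by rewrite -size_poly_gt0 ltnW.
have [c [h [c0 hP deff]]] := primitive_part f0.
have szh : size h = size f by rewrite deff size_scale.
have h0 : h != 0 by rewrite -size_poly_gt0 szh ltnW.
have hf : divides h f by exists c%:P; rewrite mul_polyC.
case: (classic (exists g, [/\ (1 < size g)%N, (size g < size h)%N & g %| h])).
  case=> g [szg ltg /Pdiv.WeakIdomain.dvdpP[[k q] /= k0 def]].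
  have g0 : g != 0 by rewrite -size_poly_gt0 ltnW.
  have [l [g' [l0 g'P defg]]] := primitive_part g0.
  have szg' : size g' = size g by rewrite defg size_scale.
  have g'h : divides g' h.
    apply: primitive_dvdp g'P _; rewrite -(dvdpZr _ _ k0) def defg -scalerAr.
    by rewrite dvdpZr // dvdp_mull.
  have [||r [rP r1 rg']] := IHn g'.
  - by apply: leq_trans len; rewrite szg' -szh.
  - by rewrite szg'.
  by exists r; split=> //; apply: divides_trans (divides_trans rg' g'h) hf.
move=> irr; exists h; split; rewrite ?szh //.
split=> // [|a b hab]; first by rewrite poly_unitE szh gtn_eqF.
have hab' : h %| a * b by case: hab => q ->; rewrite dvdp_mull.
have [ha|/negP nha] := boolP (coprimep h a).
  by right; apply: primitive_dvdp hP _; rewrite -(Gauss_dvdpr _ ha).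
left; apply: primitive_dvdp hP _.
have gh : gcdp h a %| h by apply: dvdp_gcdl.
have g0 : gcdp h a != 0 by rewrite gcdp_eq0 negb_and h0.
have: size (gcdp h a) == size h.
  rewrite eqn_leq dvdp_leq //= leqNgt; apply/negP => lt.
  apply: irr; exists (gcdp h a); split=> //.
  move/negP: nha; rewrite coprimep_def.
  by move: g0; rewrite -size_poly_gt0; case: size => [|[]].
by rewrite (dvdp_size_eqp gh) => /eqp_dvdl <-; apply: dvdp_gcdr.
Qed.

Lemma factorial_poly : factorial_ring {poly A}.
Proof.
move=> f; have [n] := ubnP (size f); elim: n => // n IHn in f *.
rewrite ltnS => len f0; have [sz1|] := leqP (size f) 1.
  have := f0; rewrite {1 2}(size1_polyC sz1) polyC_eq0 => /factA.
  case=> u [s [uU sP def]]; exists u%:P, (map polyC s); split.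
  - exact: rmorph_unit.
  - by move=> p /mapP[q /sP /prime_polyC qP ->].
  - by rewrite def polyCM big_map rmorph_prod.
case/exists_prime_factor=> h [hP h1 [q def]].
have q0 : q != 0 by apply: contraNneq f0 => q0; rewrite def q0 mul0r.
have h0 : h != 0 by rewrite -size_poly_gt0 ltnW.
have [|u [s [uU sP defq]]] := IHn q _ q0.
  apply: leq_trans len; rewrite def size_mul //.
  by move: h1; case: size => [|[|k]] //= _; rewrite !addnS ltnS leq_addr.
exists u, (h :: s); split=> // [p|]; first by rewrite in_cons => /predU1P[->|/sP].
by rewrite big_cons def defq -mulrA [_ * h]mulrC.
Qed.

End GaussLemma.

Lemma factorial_iso (A B : idomainType) (phi : {rmorphism A -> B})
    (psi : {rmorphism B -> A}) :
  cancel phi psi -> cancel psi phi -> factorial_ring B -> factorial_ring A.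
Proof.
move=> phiK psiK factB a a0.
have psi_prime p : prime_elt p -> prime_elt (psi p).
  case=> p0 pU pP; split.
  - by rewrite -(rmorph0 psi) (can_eq psiK).
  - by apply: contra pU => /(rmorph_unit phi); rewrite psiK.
  move=> x y [c def]; have : divides p (phi x * phi y).
    by exists (phi c); rewrite -rmorphM def rmorphM psiK.
  by case/pP=> -[d e]; [left|right]; exists (psi d); rewrite -rmorphM -e phiK.
have phia0 : phi a != 0 by rewrite -(rmorph0 phi) (can_eq phiK).
have [u [s [uU sP def]]] := factB _ phia0.
exists (psi u), (map psi s); split.
- exact: rmorph_unit.
- by move=> p /mapP[q /sP /psi_prime qP ->].
- by rewrite big_map -rmorph_prod -rmorphM -def phiK.
Qed.

(** * Multivariate polynomial rings are factorial *)

Section MpolyFactorial.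
Variable F : fieldType.

Lemma mpolyC_unit n (c : F) : (c%:MP_[n] \is a GRing.unit) = (c != 0).
Proof.
rewrite -[LHS]/(mpoly_unit _) /mpoly_unit mcoeffC eqxx mulr1 eqxx /=.
exact: unitfE.
Qed.

Lemma mpoly_unitE n (p : {mpoly F[n]}) :
  reflect (exists2 c, c != 0 & p = c%:MP) (p \is a GRing.unit).
Proof.
apply: (iffP idP) => [|[c c0 ->]]; last by rewrite mpolyC_unit.
case/andP=> /eqP def; rewrite unitfE => p0.
by exists p@_0.
Qed.

(** The inverse of [muni]: the outer variable becomes the last one. *)
Definition muni_inv n : {poly {mpoly F[n]}} -> {mpoly F[n.+1]} :=
  horner_eval 'X_ord_max \o map_poly (@mwiden n F).

HB.instance Definition _ n := GRing.RMorphism.copy (@muni_inv n)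
  (horner_eval 'X_ord_max \o map_poly (@mwiden n F)).

Lemma muniX_max n : muni 'X_(@ord_max n) = 'X :> {poly {mpoly F[n]}}.
Proof.
rewrite muniE msuppX big_seq1 mcoeffX eqxx mnm1E eqxx scale1r.
rewrite (_ : [multinom _ | i < n] = 0%MM) ?mpolyX0 ?scale1r ?expr1 //.
by apply/mnmP => i; rewrite mnmE mnm1E mnmE eqE /= gtn_eqF.
Qed.

Lemma muniX_widen n (i : 'I_n) :
  muni 'X_(widen_ord (leqnSn n) i) = ('X_i)%:P :> {poly {mpoly F[n]}}.
Proof.
rewrite muniE msuppX big_seq1 mcoeffX eqxx mnm1E eqE /= ltn_eqF //.
rewrite expr0 scale1r alg_polyC; congr ('X_[_])%:P.
by apply/mnmP => j; rewrite mnmE !mnm1E.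
Qed.

Lemma mpoly_morph_ext n (B : comNzRingType) (phi psi : {rmorphism {mpoly F[n]} -> B}) :
  (forall c, phi c%:MP = psi c%:MP) -> (forall i, phi 'X_i = psi 'X_i) ->
  phi =1 psi.
Proof.
move=> eqC eqX p; rewrite [p]mpolyE !rmorph_sum /=; apply: eq_bigr => m _.
rewrite -mul_mpolyC !rmorphM eqC mpolyXE_id !rmorph_prod; congr (_ * _).
by apply: eq_bigr => i _; rewrite !rmorphXn eqX.
Qed.

Lemma muni_invC n (p : {mpoly F[n]}) : muni_inv p%:P = mwiden p.
Proof. by rewrite /muni_inv /= map_polyC /horner_eval hornerC. Qed.

Lemma muni_invX n : muni_inv 'X = 'X_(@ord_max n).
Proof. by rewrite /muni_inv /= map_polyX /horner_eval hornerX. Qed.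

Lemma muniK n : cancel (@muni n F) (@muni_inv n).
Proof.
apply: (mpoly_morph_ext (phi := @muni_inv n \o @muni n F) (psi := idfun)) => [c|i] /=.
  by rewrite muniC muni_invC mwidenC.
case: (unliftP ord_max i) => [j|] ->; last by rewrite muniX_max muni_invX.
have -> : lift ord_max j = widen_ord (leqnSn n) j.
  by apply: val_inj; rewrite /= /bump leqNgt ltn_ord.
by rewrite muniX_widen muni_invC /mwiden mmapX mmap1U.
Qed.

Lemma muni_mwiden n (p : {mpoly F[n]}) : muni (mwiden p) = p%:P.
Proof.
apply: (mpoly_morph_ext (phi := @muni n F \o @mwiden n F) (psi := polyC)) => [c|i] /=.
  by rewrite mwidenC muniC.
by rewrite /mwiden mmapX mmap1U muniX_widen.
Qed.

Lemma muni_invK n : cancel (@muni_inv n) (@muni n F).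
Proof.
move=> p; elim/poly_ind: p => [|p c IHp]; first by rewrite !rmorph0.
by rewrite !(rmorphD, rmorphM) /= IHp muni_invX muniX_max muni_invC muni_mwiden.
Qed.

Lemma factorial_mpoly n : factorial_ring {mpoly F[n]}.
Proof.
elim: n => [|n IHn]; last exact: factorial_iso (@muniK n) (@muni_invK n) (factorial_poly IHn).
(* Without variables a nonzero polynomial is a nonzero constant, hence a unit. *)
move=> p p0; exists p, [::]; split=> //; last by rewrite big_nil mulr1.
apply/mpoly_unitE; exists p@_0; last first.
  apply: msize1_polyC; rewrite msizeE; apply/bigmax_leqP_seq => m _ _.
  by rewrite mdegE big_ord0.
apply: contraNneq p0 => p00; apply/eqP/mpolyP => m; rewrite mcoeff0 -p00.
by congr (_@_ _); apply/mnmP => -[].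
Qed.

End MpolyFactorial.

(** * Gcds and radicals *)

Section Gcds.
Variables (A : idomainType) (I : finType).
Hypothesis factA : factorial_ring A.
Implicit Types (f k : I -> A) (S : {set I}) (g h : A).

Lemma is_gcd1P f S :
  (forall p, prime_elt p -> ~ (forall i, i \in S -> divides p (f i))) ->
  (exists2 i, i \in S & f i != 0) -> is_gcd f S 1.
Proof.
move=> nop [i0 i0S fi0]; split=> [i _|h hf]; first by exists (f i); rewrite mulr1.
have h0 : h != 0.
  by apply: contraNneq fi0 => h0; have [c ->] := hf _ i0S; rewrite h0 mulr0.
have [u [[|p s] [uU sP def]]] := factA h0.
  by exists u^-1; rewrite def big_nil mulr1 mulVr.
have /nop[] : prime_elt p by apply: sP; rewrite mem_head.
move=> i /hf; apply: divides_trans; exists (u * \prod_(q <- s) q).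
by rewrite def big_cons mulrCA mulrC.
Qed.

(** Common primes are split off one by one; the number of prime factors of a single nonzero [f i0]
    bounds their number. *)
Lemma gcd_decomposition f S : (exists2 i, i \in S & f i != 0) ->
  exists g k, [/\ g != 0, forall i, i \in S -> f i = g * k i & is_gcd k S 1].
Proof.
case=> i0 i0S fi0; have [u [s [uU sP def]]] := factA fi0.
have [n] := ubnP (size s); elim: n => // n IHn in f fi0 u s uU sP def *.
rewrite ltnS => len.
case: (classic (exists2 p, prime_elt p & forall i, i \in S -> divides p (f i))).
  case=> p pP pf.
  have /fin_all_exists[f' f'P] : forall i, exists c, i \in S -> f i = c * p.
    move=> i; case: (boolP (i \in S)) => [/pf[c ->]|_]; first by exists c.
    by exists 0.
  have f'i0 : f' i0 != 0.
    by apply: contraNneq fi0 => e; rewrite (f'P _ i0S) e mul0r.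
  have def' : p * f' i0 = u * \prod_(q <- s) q by rewrite -def f'P // mulrC.
  have [u' [s' [u'U s'P lcq szs]]] := divide_factored pP uU sP def'.
  have [|g [k [g0 gk kP]]] := IHn f' f'i0 u' s' u'U s'P lcq; first by rewrite szs.
  exists (g * p), k; split=> // [|i iS].
    by rewrite mulf_neq0 //; case: pP.
  by rewrite f'P // gk // mulrAC.
move=> nop; exists 1, f; split=> [|i|]; rewrite ?oner_neq0 ?mul1r //.
apply: is_gcd1P => [p pP pf|]; last by exists i0.
by apply: nop; exists p.
Qed.

(** By induction on the prime factors of [g]. Such a prime [p] either divides the common divisor
    [h], and is cancelled from both, or divides every cofactor of [h], so that [h] already divides
    the products without [p]. *)
Lemma is_gcd_mul f k g S : g != 0 -> (forall i, i \in S -> f i = g * k i) ->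
  is_gcd k S 1 -> is_gcd f S g.
Proof.
move=> g0 fgk [_ k1]; split=> [i /fgk->|h hf]; first by exists (k i); rewrite mulrC.
have {f fgk hf} hf i : i \in S -> divides h (g * k i) by move=> iS; rewrite -fgk //; apply: hf.
have [u [s [uU sP def]]] := factA g0; rewrite {g g0}def in hf *.
elim: s => [|p s IHs] in h sP hf *.
  rewrite big_nil mulr1 in hf *; rewrite -[u]mulr1; apply/divides_mull/k1 => i /hf [c e].
  by exists (u^-1 * c); rewrite -mulrA -e mulKr.
have pP : prime_elt p by apply: sP; rewrite mem_head.
have [p0 _ pdvd] := pP.
have {}sP q : q \in s -> prime_elt q by move=> qs; apply: sP; rewrite in_cons qs orbT.
rewrite big_cons mulrCA; case: (classic (divides p h)) => [[h' hh']|nph].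
  have: divides h' (u * \prod_(q <- s) q).
    apply: IHs => // i /hf [c e]; exists c; apply: (mulfI p0).
    by rewrite [RHS]mulrCA [p * h']mulrC -hh' -e big_cons; rewrite !mulrA [p * u]mulrC.
  by case=> c e; exists c; rewrite hh' e mulrA mulrC.
apply/divides_mull/IHs => // i /hf [c e].
have: divides p (c * h).
  by rewrite -e big_cons; apply/divides_mulr/divides_mull/divides_mulr/dividesxx.
case/pdvd=> [[c' e']|//]; exists c'; apply: (mulfI p0).
rewrite [RHS]mulrA [p * c']mulrC -e' -e big_cons.
by rewrite !mulrA [p * u]mulrC.
Qed.

End Gcds.

Section Radicals.
Variables (F : fieldType) (n : nat).
Implicit Types p q : {mpoly F[n]}.

(** [epsilon] needs a witness. It comes from a prime factorization by grouping associates: each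
    prime either raises an exponent, its unit going into the constant, or becomes a new factor. *)
Lemma radicalP p : p != 0 -> is_radical p (radical p).
Proof.
move=> p0; apply: epsilon_spec.
suff: exists s c (P : 'I_s -> {mpoly F[n]}) e, [/\ c != 0,
    forall i, irreducible_elt (P i), forall i j, i != j -> ~ associated (P i) (P j),
    forall i, (0 < e i)%N & p = c *: \prod_i P i ^+ e i].
  by case=> s [c [P [e []]]] *; exists (\prod_i P i), s, c, P, e.
have [u [t [/mpoly_unitE[c c0 ->] tP ->]]] := factorial_mpoly p0.
elim: t tP => [|q t IHt] tP {p p0}.
  exists 0%N, c, (fun=> 0), (fun=> 0%N); split=> // [[]//|[]//|[]//|].
  by rewrite big_nil big_ord0 mulr1 alg_mpolyC.
have qP : prime_elt q by apply: tP; rewrite mem_head.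
have [r rt|s [d [P [e [d0 Pirr PN e0 def]]]]] := IHt.
  by apply: tP; rewrite in_cons rt orbT.
case: (classic (exists i, associated (P i) q)) => [[i [w wU def_q]]|nass].
  have /mpoly_unitE[b b0 def_w] := wU.
  exists s, (b * d), P, (fun j => (e j + (j == i))%N); split=> //.
  - by rewrite mulf_neq0.
  - by move=> j; rewrite addn_gt0 e0.
  have -> : \prod_j P j ^+ (e j + (j == i)) = P i * \prod_j P j ^+ e j.
    rewrite (bigD1 i) //= [in RHS](bigD1 i) //= eqxx addn1 exprS -mulrA.
    by congr (_ * (_ * _)); apply: eq_bigr => j /negPf->; rewrite addn0.
  by rewrite big_cons mulrCA def def_q def_w -scalerAr -mulrA mul_mpolyC scalerA mulrC.
exists s.+1, d, (fun i => oapp P q (unlift ord0 i)), (fun i => oapp e 1%N (unlift ord0 i)).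
split=> //.
- by move=> i; case: unliftP => [j|] _ //=; apply: prime_irreducible.
- move=> i j; case: unliftP => [i'|] -> ; case: unliftP => [j'|] -> /=.
  + by rewrite (inj_eq (@lift_inj _ _)) => /PN.
  + by move=> _ ass; apply: nass; exists i'.
  + move=> _ [w wU def_P]; apply: nass; exists j'; exists w^-1; rewrite ?unitrV //.
    by rewrite def_P mulKr.
  + by case/eqP.
- by move=> i; case: unliftP => [j|] _ /=.
rewrite big_cons mulrCA def big_ord_recl unlift_none /= expr1 -scalerAr.
congr (_ *: (_ * _)); apply: eq_bigr => i _.
by rewrite liftK.
Qed.

End Radicals.

(** * Restriction to a line *)

Section LeadingTerm.
Variable A : comNzRingType.
Implicit Types (p q : {poly A}) (c d : A) (k l : nat).

(** [c] may be 0, so [k] only bounds the degree; this makes the notion multiplicative over any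
    commutative ring. *)
Definition has_top k c p := (size p <= k.+1)%N /\ p`_k = c.

Lemma has_topM k l c d p q :
  has_top k c p -> has_top l d q -> has_top (k + l) (c * d) (p * q).
Proof.
move=> [sp <-] [sq <-]; split.
  apply: leq_trans (size_polyMleq _ _) _.
  by rewrite -subn1 leq_subLR add1n -addnS -addSn leq_add.
have lek : (k < (k + l).+1)%N by rewrite ltnS leq_addr.
rewrite coefM (bigD1 (Ordinal lek)) //= addKn big1 ?addr0 // => i.
rewrite -val_eqE /= neq_ltn => /orP[ltik|ltki].
  rewrite [q`__]nth_default ?mulr0 //; apply: leq_trans sq _.
  by rewrite ltn_subRL ltn_add2r.
by rewrite [p`__]nth_default ?mul0r //; apply: leq_trans sp _.
Qed.

Lemma has_top1 : has_top 0 1 1.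
Proof. by split; rewrite ?size_poly1 ?coef1. Qed.

Lemma has_topX k c p e : has_top k c p -> has_top (k * e) (c ^+ e) (p ^+ e).
Proof.
move=> pP; elim: e => [|e IHe]; first by rewrite muln0 !expr0; apply: has_top1.
by rewrite mulnS !exprS; apply: has_topM.
Qed.

Lemma has_top_prod (I : Type) (r : seq I) (k : I -> nat) (c : I -> A) (p : I -> {poly A}) :
  (forall i, has_top (k i) (c i) (p i)) ->
  has_top (\sum_(i <- r) k i) (\prod_(i <- r) c i) (\prod_(i <- r) p i).
Proof.
move=> pP; elim: r => [|i r IHr]; rewrite ?big_nil ?big_cons; first exact: has_top1.
exact: has_topM.
Qed.

End LeadingTerm.

Lemma poly_morph_ext (A B : nzRingType) (phi psi : {rmorphism {poly A} -> B}) :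
  (forall c, phi c%:P = psi c%:P) -> phi 'X = psi 'X -> phi =1 psi.
Proof.
move=> eqC eqX; elim/poly_ind => [|p c IHp]; first by rewrite !rmorph0.
by rewrite !(rmorphD, rmorphM) /= IHp eqC eqX.
Qed.

Section Lines.
Variables (K : fieldType) (v : nat).
Local Notation A := {mpoly K[v]}.
Implicit Types (a b : 'I_v -> K) (f g : A).

(** The substitution of [x + t b] for [x], with the base point [x] left indeterminate. *)
Definition generic_line b : A -> {poly A} :=
  mmap (polyC \o @mpolyC v K) (fun i => ('X_i)%:P + ((b i)%:MP)%:P * 'X).

HB.instance Definition _ b := GRing.RMorphism.copy (generic_line b)
  (mmap (polyC \o @mpolyC v K) (fun i => ('X_i)%:P + ((b i)%:MP)%:P * 'X)).

(** The homogeneous component of highest degree. Directions where it does not vanish are those along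
    which [f] keeps its degree. *)
Definition top_form f : A :=
  \sum_(m <- msupp f | mdeg m == tdeg f) f@_m *: 'X_[m].

Lemma top_form_neq0 f : f != 0 -> top_form f != 0.
Proof.
move=> f0; apply: contraTneq (mlead_supp f0) => top0.
rewrite mcoeff_msupp negbK; apply/eqP.
rewrite -(mcoeff0 K (mlead f)) -top0 /top_form.
rewrite [RHS]raddf_sum big_mkcond (bigD1_seq (mlead f)) ?msupp_uniq ?mlead_supp //=.
rewrite /tdeg -(mlead_deg f0) eqxx mcoeffZ mcoeffX eqxx mulr1 big1 ?addr0 // => m.
by case: ifP => // _ /negPf ne; rewrite mcoeffZ mcoeffX ne mulr0.
Qed.

Lemma generic_lineC b c : generic_line b c%:MP = (c%:MP)%:P.
Proof. by rewrite /generic_line mmapC. Qed.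

Lemma generic_lineX b i : generic_line b 'X_i = ('X_i)%:P + ((b i)%:MP)%:P * 'X.
Proof. by rewrite /generic_line mmapX mmap1U. Qed.

(** A monomial of degree [k] becomes a polynomial in [t] of degree at most [k] whose coefficient at
    [k] is its value at [b]; only monomials of full degree reach the top. *)
Lemma generic_line_top b f :
  has_top (tdeg f) ((top_form f).@[b])%:MP (generic_line b f).
Proof.
have monP m : has_top (mdeg m) (\prod_i (b i)%:MP ^+ m i : A)
    (mmap1 (fun i => ('X_i)%:P + ((b i)%:MP)%:P * 'X) m : {poly A}).
  rewrite mdegE; apply: has_top_prod => i; rewrite -[X in has_top X]mul1n.
  apply: has_topX; split; last first.
    by rewrite coefD coefC coefCM coefX mulr1 add0r.
  apply: leq_trans (size_polyD _ _) _; rewrite geq_max.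
  rewrite (leq_trans (size_polyC_leq1 _)) //.
  apply: leq_trans (size_polyMleq _ _) _; rewrite size_polyX addn2 /=.
  by rewrite ltnS size_polyC_leq1.
split.
  rewrite /generic_line /mmap; apply: leq_trans (size_sum _ _ _) _.
  apply/bigmax_leqP_seq => m mf _; rewrite mul_polyC.
  apply: leq_trans (size_scale_leq _ _) _; apply: leq_trans (proj1 (monP m)) _.
  by rewrite ltnS /tdeg -ltnS prednK ?(leq_trans _ (msize_mdeg_lt mf)) ?msize_mdeg_lt.
have -> : generic_line b f = \sum_(m <- msupp f) ((f@_m)%:MP)%:P *
    mmap1 (fun i => ('X_i)%:P + ((b i)%:MP)%:P * 'X) m by [].
rewrite coef_sum /top_form (raddf_sum (meval b)) (raddf_sum (@mpolyC v K)) /=.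
rewrite [RHS]big_mkcond /=; apply: eq_big_seq => m mf.
have [_ mtop] := monP m; rewrite coefCM; case: eqP => [e|ne].
  rewrite -e mtop mevalZ mevalX mpolyCM rmorph_prod; congr (_ * _).
  by apply: eq_bigr => i _; rewrite rmorphXn.
rewrite nth_default ?mulr0 //; apply: leq_trans (proj1 (monP m)) _.
rewrite ltn_neqAle; move/eqP: ne => -> /=.
by rewrite /tdeg -ltnS prednK ?(leq_trans _ (msize_mdeg_lt mf)) ?msize_mdeg_lt.
Qed.

Definition line a b : A -> {poly K} := map_poly (meval a) \o generic_line b.

HB.instance Definition _ a b := GRing.RMorphism.copy (line a b)
  (map_poly (meval a) \o generic_line b).

Lemma lineC a b c : line a b c%:MP = c%:P.
Proof. by rewrite /line /= generic_lineC map_polyC /= mevalC. Qed.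

Lemma lineZ a b c f : line a b (c *: f) = c *: line a b f.
Proof. by rewrite -mul_mpolyC rmorphM /= lineC mul_polyC. Qed.

Lemma line_at0 a b f : (line a b f).[0] = f.@[a].
Proof.
apply: (mpoly_morph_ext (phi := horner_eval 0 \o line a b) (psi := meval a)) => [c|i] /=.
  by rewrite lineC /horner_eval hornerC mevalC.
rewrite /line /= generic_lineX rmorphD rmorphM /= !map_polyC map_polyX /=.
by rewrite /horner_eval !hornerE mevalXU.
Qed.

Lemma size_line_leq a b f : (size (line a b f) <= (tdeg f).+1)%N.
Proof.
apply: leq_trans (proj1 (generic_line_top b f)).
exact: size_poly.
Qed.

Lemma size_line a b f : (top_form f).@[b] != 0 -> size (line a b f) = (tdeg f).+1.
Proof.
move=> topb; apply/eqP; rewrite eqn_leq size_line_leq /=.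
have : (line a b f)`_(tdeg f) != 0.
  by rewrite coef_map /= (proj2 (generic_line_top b f)) /= mevalC.
by apply: contraNltn => le; rewrite nth_default.
Qed.

(** The endomorphism of [A[t]] that fixes [t] and sends [x] to [x + t b]. *)
Definition shear b : {poly A} -> {poly A} := horner_eval 'X \o map_poly (generic_line b).

HB.instance Definition _ b := GRing.RMorphism.copy (shear b)
  (horner_eval 'X \o map_poly (generic_line b)).

Lemma shearC b f : shear b f%:P = generic_line b f.
Proof. by rewrite /shear /= map_polyC /horner_eval hornerC. Qed.

Lemma shearX b : shear b 'X = 'X.
Proof. by rewrite /shear /= map_polyX /horner_eval hornerX. Qed.

Lemma shear_generic_line b c f : (forall i, b i + c i = 0) ->
  shear c (generic_line b f) = f%:P.
Proof.
move=> bc.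
apply: (mpoly_morph_ext (phi := shear c \o generic_line b) (psi := polyC)) => [d|i] /=.
  by rewrite generic_lineC shearC generic_lineC.
rewrite generic_lineX rmorphD rmorphM /= !shearC shearX generic_lineX generic_lineC.
by rewrite -addrA -mulrDl -!polyCD -mpolyCD addrC [c i + _]addrC bc mpolyC0 polyC0 mul0r add0r.
Qed.

Lemma shearK b c : (forall i, b i + c i = 0) -> cancel (shear b) (shear c).
Proof.
move=> bc; apply: (poly_morph_ext (phi := shear c \o shear b) (psi := idfun)) => [f|] /=.
  by rewrite shearC shear_generic_line.
by rewrite (shearX b) (shearX c).
Qed.

End Lines.

(** * Wronskians *)

Lemma poly_nonroot (K : numDomainType) (p : {poly K}) : p != 0 -> exists x, p.[x] != 0.
Proof.
move=> p0; apply: NNPP => nex.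
have allroot x : root p x.
  by apply: contraT => px; case: nex; exists x.
have := @max_poly_roots K p [seq i%:R | i <- iota 0 (size p)] p0.
rewrite size_map size_iota ltnn => H; suff: false by []; apply: H.
  by apply/allP => x _; apply: allroot.
by rewrite map_inj_uniq ?iota_uniq //; apply: (mulrIn (oner_neq0 K)).
Qed.

Section Wronskian.
Variable K : numFieldType.
Implicit Types (p q : {poly K}) (x : K).

(** The falling factorial is nonzero in characteristic 0, so [j] derivations lower the order at [x]
    by exactly [j] when [q] does not vanish there. *)
Lemma derivn_XsubCX x m q j : (j <= m)%N ->
  exists2 r, (('X - x%:P) ^+ m * q)^`(j) = ('X - x%:P) ^+ (m - j) * r
    & r.[x] = (m ^_ j)%:R * q.[x].
Proof.
elim: j => [|j IHj] ltjm; first by exists q; rewrite ?subn0 // ffactn0 mul1r.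
have [r def rx] := IHj (ltnW ltjm).
exists (r *+ (m - j) + ('X - x%:P) * r^`()).
  rewrite derivnS def derivM deriv_exp derivXsubC mul1r -(subnSK ltjm) /=.
  by rewrite mulrDr mulrA -exprSr mulrnAl mulrnAr.
rewrite ffactnSr hornerD hornerM hornerMn !hornerE subrr mul0r addr0 rx.
by rewrite mulnC natrM -mulrA [RHS]mulr_natl.
Qed.

Lemma mup_factor x p : p != 0 -> exists2 q, p = ('X - x%:P) ^+ mup x p * q & q.[x] != 0.
Proof.
move=> p0; have [m [q]] := multiplicity_XsubC p x; rewrite p0 /= => qx def.
exists q; last by rewrite -rootE.
suff -> : mup x p = m by rewrite mulrC.
by rewrite def mupMr // mup_XsubCX eqxx.
Qed.

Lemma dvdp_derivn x p j : ('X - x%:P) ^+ (mup x p - j) %| p^`(j).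
Proof.
have [->|p0] := eqVneq p 0; first by rewrite raddf0 dvdp0.
have [lej|ltj] := leqP j (mup x p); last first.
  by rewrite (eqP (ltnW ltj)) expr0 dvd1p.
have [q def _] := mup_factor x p0; have [r e _] := derivn_XsubCX x q lej.
by rewrite {2}def e dvdp_mulIl.
Qed.

Lemma mup_le x p m q : p = ('X - x%:P) ^+ m * q -> q.[x] != 0 ->
  forall n, ('X - x%:P) ^+ n %| p -> (n <= m)%N.
Proof.
move=> def qx n; have q0 : q != 0 by apply: contraNneq qx => ->; rewrite horner0.
have p0 : p != 0 by rewrite def mulf_neq0 ?expf_neq0 ?polyXsubC_eq0.
rewrite -mup_geq // def mupM ?expf_neq0 ?polyXsubC_eq0 //.
by rewrite mup_XsubCX eqxx (mupNroot qx) addn0.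
Qed.

Definition wronskian e (phi : 'I_e -> {poly K}) : {poly K} :=
  \det (\matrix_(i < e, j < e) (phi i)^`(j)).

Lemma wronskian_change e (phi psi : 'I_e -> {poly K}) (B : 'M[K]_e) :
  (forall i, psi i = \sum_j B i j *: phi j) ->
  wronskian psi = \det B *: wronskian phi.
Proof.
move=> def; rewrite -mul_polyC -det_map_mx -det_mulmx; congr (\det _).
apply/matrixP => i j; rewrite !mxE def raddf_sum; apply: eq_bigr => l _.
by rewrite !mxE /= derivnZ mul_polyC.
Qed.

(** A power of [X - x] is pulled out of each row: derivation costs at most [e.-1] in the order of a
    row that vanishes at [x], and nothing for the others, where the truncated [m i] is 0. *)
Lemma wronskian_mup e (phi : 'I_e -> {poly K}) x : wronskian phi != 0 ->
  (\sum_i mup x (phi i) <=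
     mup x (wronskian phi) + e.-1 * \sum_i root (phi i) x)%N.
Proof.
move=> W0; pose m i := (mup x (phi i) - e.-1)%N.
have dvdW : ('X - x%:P) ^+ (\sum_i m i) %| wronskian phi.
  pose N : 'M_e := \matrix_(i, j) ((phi i)^`(j) %/ ('X - x%:P) ^+ m i).
  have -> : wronskian phi = \det (diag_mx (\row_i ('X - x%:P) ^+ m i) *m N).
    congr (\det _); apply/matrixP => i j; rewrite mul_diag_mx !mxE divpKC //.
    apply: dvdp_trans (dvdp_derivn x _ j); apply: dvdp_exp2l.
    by apply: leq_sub2l; rewrite -ltnS (ltn_predK (ltn_ord j)).
  rewrite det_mulmx det_diag; apply: dvdp_mulr.
  rewrite (eq_bigr (fun i => ('X - x%:P) ^+ m i)) => [|i _]; last by rewrite mxE.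
  by rewrite -expr_sum.
rewrite -mup_geq // in dvdW.
apply: leq_trans (leq_add dvdW (leqnn _)).
rewrite big_distrr -big_split /=; apply: leq_sum => i _.
have [r|nr] := boolP (root (phi i) x); last by rewrite mupNroot.
by rewrite muln1 addnC -leq_subLR.
Qed.

Lemma size_derivn_leq p j : (size p^`(j) <= size p - j)%N.
Proof.
elim: j => [|j IHj]; first by rewrite subn0.
rewrite derivnS subnS; apply: leq_trans (_ : (size p^`(j)).-1 <= _)%N; last first.
  by rewrite -!subn1 leq_sub2r.
have [->|p0] := eqVneq p^`(j) 0; first by rewrite deriv0 size_poly0.
by rewrite -ltnS prednK ?size_poly_gt0 // lt_size_deriv.
Qed.

Lemma degree_prod (I : finType) (F : I -> {poly K}) : (forall i, F i != 0) ->
  (size (\prod_i F i)).-1 = (\sum_i (size (F i)).-1)%N.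
Proof.
move=> F0; suff [] : \prod_i F i != 0 /\ (size (\prod_i F i)).-1 = (\sum_i (size (F i)).-1)%N by [].
elim/big_rec2: _ => [|i n p _ [p0 <-]]; first by rewrite oner_neq0 size_poly1.
rewrite mulf_neq0 // size_mul //; split=> //; move: (F0 i) p0.
rewrite -!size_poly_gt0; case: (size (F i)) => // a _; case: size => // c _.
by rewrite addnS.
Qed.

(** Every term of the determinant uses each order of derivation from 0 to [e - 1] once, and each
    derivation lowers the degree. *)
Lemma size_wronskian e (phi : 'I_e -> {poly K}) : wronskian phi != 0 ->
  ((size (wronskian phi)).-1 + \sum_(j < e) j <= \sum_i (size (phi i)).-1)%N.
Proof.
move=> W0; pose t (s : 'S_e) := \prod_i (phi i)^`(s i).
have tP s : t s != 0 -> ((size (t s)).-1 + \sum_(j < e) j <= \sum_i (size (phi i)).-1)%N.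
  move=> t0; have p0 i : (phi i)^`(s i) != 0 by move/prodf_neq0: t0; apply.
  rewrite /t degree_prod // [X in (_ + X)%N](reindex_inj (@perm_inj _ s)) /= -big_split /=.
  apply: leq_sum => i _; have := size_derivn_leq (phi i) (s i); move: (p0 i).
  rewrite -size_poly_gt0; case: size => // k _; rewrite ltn_subRL addnC => ltk.
  by rewrite /= -ltnS (ltn_predK ltk).
(* A nonzero term shows that the sum of the degrees is at least the sum of the orders, so the
   natural subtraction below is exact. *)
have [s0 ts0] : exists s, t s != 0.
  apply: NNPP => nt; case/eqP: W0; rewrite /wronskian /determinant big1 // => s _.
  suff -> : \prod_i (\matrix_(i0, j) (phi i0)^`(j)) i (s i) = 0 by rewrite mulr0.
  under eq_bigr do rewrite mxE.
  by apply/eqP/negPn/negP => ts; apply: nt; exists s.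
have leT := leq_trans (leq_addl _ _) (tP _ ts0).
rewrite -(subnK leT) leq_add2r -ltnS prednK ?size_poly_gt0 //.
apply: leq_trans (size_sum _ _ _) _; apply/bigmax_leqP => s _.
rewrite size_Msign (eq_bigr (fun i => (phi i)^`(s i))) => [|i _]; last by rewrite mxE.
rewrite -/(t s).
have [-> |ts] := eqVneq (t s) 0; first by rewrite size_poly0.
by rewrite -[size _]prednK ?size_poly_gt0 // ltnS leq_subRL // addnC tP.
Qed.

(* A vanishing Wronskian gives a linear differential operator of order < e
   killing every phi i; at a point where its leading coefficient does not
   vanish, some combination of the phi i vanishes to that order, hence is 0. *)
Lemma wronskian_neq0 e (phi : 'I_e -> {poly K}) :
  (forall a : 'I_e -> K, \sum_i a i *: phi i = 0 -> forall i, a i = 0) ->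
  wronskian phi != 0.
Proof.
move=> indep; apply/negP; rewrite /wronskian -det_tr.
case/det0P => v v0 vM.
have [j0 vj0] : exists j, v 0 j != 0 by apply/rV0Pn.
pose top := [arg max_(j > j0 | v 0 j != 0) (j : nat)].
have [vtop vlt] : v 0 top != 0 /\ forall j : 'I_e, (top < j)%N -> v 0 j = 0.
  rewrite /top; case: arg_maxnP => // j vj jmax; split=> // l ltl.
  by apply/eqP; apply: contraLR ltl => /jmax; rewrite -leqNgt.
have ode i : \sum_(j < e) v 0 j * (phi i)^`(j) = 0.
  have /matrixP/(_ 0 i) := vM; rewrite !mxE => vMi; rewrite -[RHS]vMi.
  by apply: eq_bigr => j _; rewrite !mxE.
have [x vx] := poly_nonroot vtop.
(* Column [top] of [N] is 0, so [N] is singular; a vector of its left kernel gives a combination [p]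
   whose derivatives of order below [top] vanish at [x]. *)
pose N : 'M[K]_e := \matrix_(i, j) if (j < top)%N then (phi i)^`(j).[x] else 0.
have /det0P[a a0 aN] : \det N == 0.
  rewrite -det_tr; apply/det0P; exists (delta_mx 0 top).
    by apply/rV0Pn; exists top; rewrite mxE !eqxx oner_neq0.
  by apply/rowP => i; rewrite -rowE !mxE ltnn.
pose p := \sum_i a 0 i *: phi i.
have pd j : p^`(j) = \sum_i a 0 i *: (phi i)^`(j).
  by rewrite raddf_sum; apply: eq_bigr => i _; rewrite /= derivnZ.
have p0 : p != 0.
  apply: contraNneq a0 => /indep a0; apply/eqP/rowP => i; by rewrite mxE a0.
have pN (j : nat) : (j < top)%N -> p^`(j).[x] = 0.
  move=> lt; have lte : (j < e)%N by apply: ltn_trans lt _.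
  have /matrixP/(_ 0 (Ordinal lte)) := aN; rewrite !mxE => aNj; rewrite -[RHS]aNj.
  rewrite pd horner_sum; apply: eq_bigr => i _.
  by rewrite !mxE /= lt hornerZ.
have [q defp qx] := mup_factor x p0; set m := mup x p in defp.
have ffact_neq0 j : (j <= m)%N -> (m ^_ j)%:R != 0 :> K.
  by move=> lej; rewrite pnatr_eq0 -lt0n ffact_gt0.
have letop : (top <= m)%N.
  rewrite leqNgt; apply/negP => /pN/eqP.
  have [r e1 rx] := derivn_XsubCX x q (leqnn m).
  by rewrite defp e1 subnn expr0 mul1r rx mulf_eq0 (negPf qx) (negPf (ffact_neq0 _ (leqnn m))).
have [r e1 rx] := derivn_XsubCX x q letop; rewrite -defp in e1.
have r0 : r.[x] != 0 by rewrite rx mulf_neq0 ?ffact_neq0.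
(* The order of the derivative number [top] is exactly [m - top], whereas the equation expresses it,
   up to [v 0 top], through lower derivatives, which have larger order. *)
suff: ('X - x%:P) ^+ (m - top).+1 %| p^`(top).
  by move/(mup_le e1 r0); rewrite ltnn.
have cop : coprimep (('X - x%:P) ^+ (m - top).+1) (v 0 top).
  by rewrite coprimep_expl // coprimep_sym coprimep_XsubC.
rewrite -(Gauss_dvdpr _ cop).
have : \sum_(j < e) v 0 j * p^`(j) = 0.
  under eq_bigr do rewrite pd big_distrr.
  rewrite exchange_big big1 // => i _ /=; under eq_bigr do rewrite -scalerAr.
  by rewrite -scaler_sumr ode scaler0.
rewrite (bigD1 top) //= => /eqP; rewrite addr_eq0 => /eqP ->.
rewrite dvdpNr; apply: (big_ind (fun s => _ %| s)) => [||j netop]; [exact: dvdp0 | by move=> *; apply: dvdp_add |].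
have [lt|gt|/val_inj e2] := ltngtP j top; last by rewrite e2 eqxx in netop.
  apply: dvdp_mull; apply: dvdp_trans (dvdp_derivn x p j); apply: dvdp_exp2l.
  by rewrite -subSn // -[(m - j)%N]subSS leq_sub2l.
by rewrite vlt // mul0r dvdp0.
Qed.

End Wronskian.

(** * Roots and points in general position *)

Section Roots.
Variable K : closedFieldType.
Implicit Types (p : {poly K}) (Z : seq K).

Lemma sum_mup p Z : p != 0 -> uniq Z ->
  (\sum_(x <- Z) mup x p <= (size p).-1)%N /\
  ({subset [pred x | root p x] <= Z} -> \sum_(x <- Z) mup x p = (size p).-1)%N.
Proof.
move=> p0 uZ; have [r def] := closed_field_poly_normal p.
have lc0 : lead_coef p != 0 by rewrite lead_coef_eq0.
have mupE x : mup x p = count_mem x r.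
  rewrite def -mul_polyC mupMr ?mu_prod_XsubC //.
  by rewrite rootE hornerC lead_coef_eq0.
have szr : (size p).-1 = size r.
  by rewrite def size_scale // size_prod_XsubC.
have cnt (s : seq K) : (\sum_(x <- Z) count_mem x s = count (mem Z) s)%N.
  elim: s => [|y s IHs] /=; first by rewrite big1.
  rewrite big_split /= IHs; congr (_ + _)%N.
  have [yZ|nyZ] := boolP (y \in Z).
    rewrite (bigD1_seq y) //= eqxx big1 // => x /negPf ne.
    by rewrite eq_sym ne.
  rewrite big1_seq // => x /andP[_ xZ]; by case: eqP => // e; rewrite e xZ in nyZ.
under eq_bigr do rewrite mupE.
rewrite cnt szr; split; first exact: count_size.
move=> sub; apply/eqP; rewrite -all_count; apply/allP => x xr; apply: sub.
by rewrite inE def rootZ // root_prod_XsubC.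
Qed.

End Roots.

(** Choose the first coordinates off the zeros of the leading coefficient in the last variable, then
    the last coordinate off the roots of the univariate polynomial that results. *)
Lemma mpoly_nonroot (K : numFieldType) n (p : {mpoly K[n]}) :
  p != 0 -> exists a, p.@[a] != 0.
Proof.
elim: n p => [|n IHn] p p0.
  exists (fun=> 0); apply: contraNneq p0 => pe0.
  have def : p = (p@_0)%:MP.
    apply: msize1_polyC; rewrite msizeE; apply/bigmax_leqP_seq => m _ _.
    by rewrite mdegE big_ord0.
  by rewrite def mevalC in pe0 *; rewrite pe0 mpolyC0.
have mp0 : muni p != 0 by rewrite -(rmorph0 (@muni n K)) (can_eq (@muniK K n)).
have [a lca] : exists a, (lead_coef (muni p)).@[a] != 0.
  by apply: IHn; rewrite lead_coef_eq0.
have qp0 : map_poly (meval a) (muni p) != 0.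
  apply: contraNneq lca => q0; have := coef_map (meval a) (muni p) (size (muni p)).-1.
  by rewrite q0 coef0 => /esym /= ->.
have [x qx] := poly_nonroot qp0.
pose c i := if unlift ord_max i is Some j then a j else x.
suff E : horner_eval x \o (map_poly (meval a) \o @muni n K) =1 meval c.
  by exists c; move: qx; rewrite -[_.[x]]/((horner_eval x \o (map_poly (meval a) \o @muni n K)) p) E.
apply: mpoly_morph_ext => [d|i] /=.
  by rewrite muniC map_polyC /horner_eval hornerC /= !mevalC.
rewrite mevalXU /c; case: unliftP => [j|] ->.
  have -> : lift ord_max j = widen_ord (leqnSn n) j.
    by apply: val_inj; rewrite /= /bump leqNgt ltn_ord.
  by rewrite muniX_widen map_polyC /horner_eval hornerC /= mevalXU.
by rewrite muniX_max map_polyX /horner_eval hornerX.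
Qed.

(** Applied to the product; it lets finitely many genericity conditions be met at once. *)
Lemma common_nonroot (K : numFieldType) n (J : finType) (P : pred J) (p : J -> {mpoly K[n]}) :
  (forall j, P j -> p j != 0) -> exists a, forall j, P j -> (p j).@[a] != 0.
Proof.
move=> p0; have [a pa] : exists a, (\prod_(j | P j) p j).@[a] != 0.
  by apply: mpoly_nonroot; apply/prodf_neq0.
by exists a => j Pj; move: pa; rewrite rmorph_prod => /prodf_neq0; apply.
Qed.

(* G is an element of minimal degree of the ideal generated by the F i. *)
Lemma ideal_generator (A : idomainType) (I : finType) (F : I -> {poly A}) (S : {set I}) :
  (exists2 i, i \in S & F i != 0) ->
  exists G U, [/\ G != 0, G = \sum_(i in S) U i * F i & forall i, i \in S -> G %| F i].
Proof.
case=> i0 i0S Fi0.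
suff: forall n G U, G != 0 -> G = \sum_(i in S) U i * F i -> (size G < n)%N ->
    exists G U, [/\ G != 0, G = \sum_(i in S) U i * F i & forall i, i \in S -> G %| F i].
  move/(_ _ (F i0) (fun i => (i == i0)%:R) Fi0); apply; last exact: ltnSn.
  rewrite (bigD1 i0) //= eqxx mul1r big1 ?addr0 // => i /andP[_ /negPf->].
  by rewrite mul0r.
elim=> // n IHn G U G0 defG; rewrite ltnS => len.
case: (classic (forall i, i \in S -> G %| F i)) => [?|]; first by exists G, U.
move=> /not_all_ex_not[j nj]; have [jS /negP ndvd] := imply_to_and _ _ nj.
have := Pdiv.WeakIdomain.divp_eq (F j) G.
set c := (_ ^+ _) => def.
(* The pseudo-remainder is a smaller element of the ideal; [c] is the power of the leading
   coefficient of [G] in the pseudo-division. *)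
apply: (IHn (F j %% G) (fun i => (i == j)%:R * c%:P - (F j %/ G) * U i)).
- by move: ndvd.
- under eq_bigr do rewrite mulrBl -!mulrA.
  rewrite sumrB -big_distrr /= -defG (bigD1 j) //= eqxx mul1r big1 ?addr0.
    by rewrite mul_polyC def addrC addKr.
  by move=> i /andP[_ /negPf->]; rewrite mul0r.
- by apply: leq_trans len; rewrite ltn_modp.
Qed.

Section CoprimeOnLine.
Variables (K : fieldType) (v : nat) (I : finType).
Local Notation A := {mpoly K[v]}.

(* The shear t |-> t, x |-> x - t b is an automorphism of A[t] which sends
   k (x + t b) back to k, so a common factor on the generic line is a common
   factor of the k i. *)
Lemma Bezout_generic_line (k : I -> A) (S : {set I}) (b : 'I_v -> K) :
  (exists2 i, i \in S & k i != 0) -> is_gcd k S 1 ->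
  exists r U, r != 0 /\ \sum_(i in S) U i * generic_line b (k i) = r%:P.
Proof.
move=> [i0 i0S ki0] [_ k1].
have factA : factorial_ring {mpoly K[v]} := @factorial_mpoly K v.
pose nb i := - b i.
have bn i : b i + nb i = 0 by rewrite subrr.
have nbb i : nb i + b i = 0 by rewrite addNr.
have lineK f : shear nb (generic_line b f) = f%:P by apply: shear_generic_line.
have [|G [U [G0 defG dvdG]]] := @ideal_generator _ _ (fun i => generic_line b (k i)) S.
  exists i0 => //; apply: contraNneq ki0 => e.
  by have := lineK (k i0); rewrite e rmorph0 => /esym/eqP; rewrite polyC_eq0.
have [sz1|sz1] := leqP (size G) 1.
  exists G`_0, U; rewrite -defG -size1_polyC //; split=> //.
  by rewrite -polyC_eq0 -size1_polyC.
(* Passing to the primitive part turns divisibility up to constants into true divisibility, which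
   the shear preserves. *)
have [c [G1 [c0 G1prim defG1]]] := primitive_part factA G0.
have dvdG1 i : i \in S -> divides G1 (generic_line b (k i)).
  move=> /dvdG; rewrite defG1 => H.
  by apply: (primitive_dvdp factA G1prim); rewrite dvdpZl in H.
have sdvd i : i \in S -> divides (shear nb G1) (k i)%:P.
  by move=> /dvdG1 [q e]; exists (shear nb q); rewrite -(lineK (k i)) e (rmorphM (shear nb)).
(* The sheared [G1] divides a nonzero polynomial free of [t], so it is free of [t] itself; as a
   common divisor of the [k i] it is a unit, and so is [G1], against its size. *)
have szG1 : size (shear nb G1) = 1%N.
  have [q e] := sdvd _ i0S.
  have p0 : (k i0)%:P != 0 by rewrite polyC_eq0.
  have q0 : q != 0 by apply: contraNneq p0 => q0; rewrite e q0 mul0r.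
  have s0 : shear nb G1 != 0 by apply: contraNneq p0 => s0; rewrite e s0 mulr0.
  have := size_polyC (k i0); rewrite e size_mul // ki0.
  move: q0 s0; rewrite -!size_poly_gt0; case: (size q) => // a; case: size => // d _ _.
  by rewrite addSn /= addnS => -[]; case: a d => [|a] [|d].
have def : shear nb G1 = ((shear nb G1)`_0)%:P by rewrite -size1_polyC ?szG1.
have [|d d1] := k1 (shear nb G1)`_0.
  move=> i /sdvd [q e]; exists q`_0; have := congr1 (coefp 0) e.
  by rewrite {1}def /= coefMC coefC.
have : size G1 = 1%N.
  rewrite -(shearK nbb G1) def shearC.
  have /mpoly_unitE[e e0 ->] : (shear nb G1)`_0 \is a GRing.unit.
    by apply/unitrPr; exists d; rewrite mulrC -d1.
  by rewrite generic_lineC size_polyC mpolyC_eq0 e0.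
by move: sz1; rewrite defG1 size_scale // => + e1; rewrite e1.
Qed.

(** [r] is independent of [a]: off its zeros, the restrictions of the [k i] are coprime. *)
Lemma Bezout_line (k : I -> A) (S : {set I}) (b : 'I_v -> K) :
  (exists2 i, i \in S & k i != 0) -> is_gcd k S 1 ->
  exists2 r : A, r != 0 & forall a, exists U,
    \sum_(i in S) U i * line a b (k i) = (r.@[a])%:P.
Proof.
move=> k0 kg; have [r [U [r0 def]]] := Bezout_generic_line b k0 kg.
exists r => // a; exists (fun i => map_poly (meval a) (U i)).
have := congr1 (map_poly (meval a)) def; rewrite map_polyC /= => <-.
by rewrite rmorph_sum; apply: eq_bigr => i _; rewrite rmorphM.
Qed.

End CoprimeOnLine.

(** * Bases of the span of a family *)

Section SpanOfFamily.
Variables (K : fieldType) (V : vectType K) (I : finType) (v : I -> V).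
Implicit Types (B M J T : {set I}) (s : V).

Definition span_of B : {vspace V} := (\sum_(i in B) <[v i]>)%VS.

Lemma span_ofP B s :
  reflect (exists a : I -> K, s = \sum_(i in B) a i *: v i) (s \in span_of B).
Proof.
apply: (iffP (memv_sumP)) => [[w wP ->]|[a ->]].
  have /fin_all_exists[a aP] : forall i, exists c, i \in B -> w i = c *: v i.
    move=> i; case: (boolP (i \in B)) => [/wP /vlineP[c ->]|_]; first by exists c.
    by exists 0.
  by exists a; apply: eq_bigr => i /aP.
by exists (fun i => a i *: v i) => // i _; rewrite memvZ ?memv_line.
Qed.

Lemma span_of_mem B i : i \in B -> v i \in span_of B.
Proof. by move=> iB; rewrite (subvP (sumv_sup i iB (subvv _))) ?memv_line. Qed.

Lemma span_ofS B M : B \subset M -> (span_of B <= span_of M)%VS.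
Proof.
move=> sBM; apply/subv_sumP => i iB; rewrite -memvE.
by apply/span_of_mem/(subsetP sBM).
Qed.

Lemma span_ofU B M : span_of (B :|: M) = (span_of B + span_of M)%VS.
Proof.
apply/eqP; rewrite eqEsubv subv_add !span_ofS ?subsetUl ?subsetUr // !andbT.
apply/subv_sumP => i; rewrite inE -memvE => /orP[] /span_of_mem; apply: subvP.
  exact: addvSl.
exact: addvSr.
Qed.

Lemma dim_span_of B : (\dim (span_of B) <= #|B|)%N.
Proof.
apply: leq_trans (dimv_leq_sum _ _ _) _; rewrite -sum1_card.
by apply: leq_sum => i _; rewrite dim_vline leq_b1.
Qed.

Lemma span_ofD1 B j (a : I -> K) : j \in B -> a j != 0 ->
  \sum_(i in B) a i *: v i = 0 -> span_of (B :\ j) = span_of B.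
Proof.
move=> jB aj; rewrite (big_setD1 j) //= => /eqP; rewrite addr_eq0 => /eqP def.
apply/eqP; rewrite eqEsubv span_ofS ?subD1set //=; apply/subv_sumP => i iB.
rewrite -memvE; have [->|ne] := eqVneq i j; last by rewrite span_of_mem // !inE ne.
have -> : v j = (- (a j)^-1) *: \sum_(i in B :\ j) a i *: v i.
  by rewrite -[\sum_(i in _) _]opprK -def scalerN scaleNr opprK scalerA mulVf // scale1r.
by rewrite memvZ //; apply/span_ofP; exists a.
Qed.

(** Bases are subfamilies; a spanning set with as many elements as the dimension is free. *)
Definition basis_in M B : Prop :=
  [/\ B \subset M, span_of B = span_of M & #|B| = \dim (span_of M)].

Lemma basis_independent M B (a : I -> K) : basis_in M B ->
  \sum_(i in B) a i *: v i = 0 -> forall i, i \in B -> a i = 0.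
Proof.
move=> [_ sB cB] a0 j jB; apply/eqP; apply/negPn; apply/negP => aj.
have := dim_span_of (B :\ j).
by rewrite (span_ofD1 jB aj a0) sB -cB [X in (X <= _)%N](cardsD1 j) jB ltnn.
Qed.

Lemma dim_span_of_free B :
  (forall a : I -> K, \sum_(i in B) a i *: v i = 0 -> forall i, i \in B -> a i = 0) ->
  \dim (span_of B) = #|B|.
Proof.
move=> free; have dirB : directv (\sum_(i in B) <[v i]>).
  apply/directv_sum_independent => u uP u0 i iB.
  have /fin_all_exists[a aP] : forall i, exists c, i \in B -> u i = c *: v i.
    move=> j; case: (boolP (j \in B)) => [/uP /vlineP[c ->]|_]; first by exists c.
    by exists 0.
  rewrite aP // (free a) ?scale0r // -[RHS]u0.
  by apply: eq_bigr => j /aP.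
move/directvP: dirB => /= ->; rewrite -sum1_card; apply: eq_bigr => i iB.
rewrite dim_vline; case: eqP => // vi0.
suff /free/(_ i iB)/eqP : \sum_(j in B) (j == i)%:R *: v j = 0.
  by rewrite eqxx oner_eq0.
rewrite (bigD1 i) //= vi0 scaler0 add0r big1 // => j /andP[_ /negPf->].
by rewrite scale0r.
Qed.

(* The properties of a minimal [J] whose span meets that of [M] in [s] <> 0. *)
Record ear M J s : Prop := Ear {
  ear_disjoint : [disjoint M & J];
  ear_neq0 : s != 0;
  ear_meml : s \in span_of M;
  ear_memr : s \in span_of J;
  ear_free : \dim (span_of J) = #|J|;
  ear_dim : (\dim (span_of (M :|: J))).+1 = (\dim (span_of M) + #|J|)%N;
  ear_span : forall j, j \in J -> span_of (M :|: J :\ j) = span_of (M :|: J) }.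

Lemma ear_exists M T : M \subset T ->
  (span_of M :&: span_of (T :\: M) != 0)%VS ->
  exists J s, J \subset T :\: M /\ ear M J s.
Proof.
move=> sMT ndisj.
pose P J := (span_of M :&: span_of J != 0)%VS.
have [J minJ sJ] := minset_exists (P := P) ndisj.
have [PJ Jmin] := minsetP minJ.
(* By minimality of [J], dropping any element leaves no intersection; all properties of the ear
   follow from this. *)
have disj j : j \in J -> (span_of M :&: span_of (J :\ j) = 0)%VS.
  move=> jJ; apply/eqP; apply/negPn; apply/negP => PJj; have := Jmin _ PJj (subD1set _ _).
  by move/setP/(_ j); rewrite !inE eqxx jJ.
have indep (a : I -> K) j : j \in J -> \sum_(i in J) a i *: v i \in span_of M ->
    a j = 0 -> \sum_(i in J) a i *: v i = 0.
  move=> jJ aM aj; have : \sum_(i in J) a i *: v i \in (span_of M :&: span_of (J :\ j))%VS.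
    rewrite memv_cap aM /=; apply/span_ofP; exists a.
    by rewrite (big_setD1 j) //= aj scale0r add0r.
  by rewrite disj // memv0 => /eqP.
(* In a dependent [J] some element could be dropped without changing the span. *)
have free_dim : \dim (span_of J) = #|J|.
  apply: dim_span_of_free => a a0 j jJ; apply/eqP; apply/negPn; apply/negP => aj.
  by move: PJ; rewrite /P -(span_ofD1 jJ aj a0) disj ?eqxx.
pose s := vpick (span_of M :&: span_of J).
have s0 : s != 0 by rewrite vpick0.
have : s \in (span_of M :&: span_of J)%VS by apply: memv_pick.
rewrite memv_cap => /andP[sM sJ'].
(* All coefficients of [s] on [J] are nonzero, so each [v j] is recovered from [s], which lies in
   the span of [M], and the other elements of [J]. *)
have spanE j : j \in J -> span_of (M :|: J :\ j) = span_of (M :|: J).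
  move=> jJ; have /span_ofP[a def] := sJ'.
  have aj : a j != 0.
    by apply: contraNneq s0 => aj; rewrite def (indep _ _ jJ _ aj) // -def.
  apply/eqP; rewrite eqEsubv !span_ofU addvS ?span_ofS ?subD1set //= subv_add addvSl /=.
  apply/subv_sumP => i iJ; rewrite -memvE; have [->|ne] := eqVneq i j; last first.
    by apply: subvP (addvSr _ _) _ _; rewrite span_of_mem // !inE ne.
  have -> : v j = (a j)^-1 *: (s - \sum_(i in J :\ j) a i *: v i).
    by rewrite def (big_setD1 j) //= addrK scalerA mulVf // scale1r.
  rewrite memvZ // memv_add // memvN; apply/span_ofP; by exists a.
exists J, s; split=> //; split=> //.
  by rewrite disjoint_sym disjoints_subset (subset_trans sJ) // setDE subsetIr.
have [J0|[j jJ]] := set_0Vmem J.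
  by move: PJ; rewrite /P J0 /span_of big_set0 capv0 eqxx.
rewrite -(spanE j jJ) span_ofU dimv_disjoint_sum ?disj // -addnS; congr (_ + _)%N.
apply/eqP; rewrite eqn_leq {1}(cardsD1 j) jJ add1n ltnS dim_span_of /=.
rewrite -free_dim -{1}(setD1K jJ) setUC span_ofU.
apply: leq_trans (dimv_add_leqif _ _) _; rewrite -addn1 leq_add2l.
by rewrite (leq_trans (dim_span_of _)) ?cards1.
Qed.

End SpanOfFamily.

(** * The univariate inequality *)

Lemma enum_card (I : finType) (B : {set I}) e : #|B| = e ->
  exists2 sigma : 'I_e -> I, injective sigma & B = [set sigma i | i in 'I_e].
Proof.
move=> <-; exists enum_val; first exact: enum_val_inj.
apply/setP => i; apply/idP/imsetP => [iB|[j _ ->]]; last exact: enum_valP.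
by exists (enum_rank_in iB i); rewrite ?enum_rankK_in.
Qed.

Section ProductsOfPowers.
Variable K : fieldType.
Implicit Types (Z : seq K) (c : K -> nat) (p : {poly K}).

Lemma prod_XsubC_mup Z c p : p != 0 -> uniq Z ->
  (forall x, x \in Z -> (c x <= mup x p)%N) ->
  \prod_(x <- Z) ('X - x%:P) ^+ c x %| p.
Proof.
move=> p0; elim: Z => [|x Z IHZ] /=; first by rewrite big_nil dvd1p.
case/andP=> nxZ uZ cP; rewrite big_cons Gauss_dvdp.
  rewrite -mup_geq // cP ?mem_head // IHZ // => y yZ.
  by rewrite cP // in_cons yZ orbT.
apply: coprimep_expl; rewrite coprimep_sym coprimep_XsubC.
rewrite rootE horner_prod prodf_seq_neq0; apply/allP => y yZ /=.
rewrite horner_exp !hornerE expf_neq0 // subr_eq0.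
by apply: contraNneq nxZ => ->.
Qed.

Lemma size_prod_XsubCX Z c :
  size (\prod_(x <- Z) ('X - x%:P) ^+ c x) = (\sum_(x <- Z) c x).+1.
Proof.
elim: Z => [|x Z IHZ]; first by rewrite !big_nil size_poly1.
rewrite !big_cons size_mul ?IHZ ?size_exp_XsubC ?expf_neq0 ?polyXsubC_eq0 //.
  by rewrite addnS.
by rewrite -size_poly_gt0 IHZ.
Qed.

End ProductsOfPowers.

Section Univariate.
Variables (K : numClosedFieldType) (I : finType) (o : I) (F : I -> {poly K}).
Hypothesis F_neq0 : forall i, F i != 0.
Variable Z : seq K.
Hypotheses (uniqZ : uniq Z) (rootsZ : forall i x, root (F i) x -> x \in Z).

(** All [F i] live in the finite-dimensional space of polynomials of size at most [N], where [\dim]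
    applies. *)
Let N := (\max_i size (F i))%N.
Let v i : 'rV[K]_N := poly_rV (F i).
Let deg i := (size (F i)).-1.
Let w x i := mup x (F i).
Implicit Types (B M J T : {set I}) (s : 'rV[K]_N) (c : K -> nat).

Lemma rVpoly_family i : rVpoly (v i) = F i.
Proof. by rewrite poly_rV_K // /N (leq_bigmax i). Qed.

Lemma rVpoly_comb (J : finType) (P : pred J) (a : J -> K) (g : J -> I) :
  rVpoly (\sum_(i | P i) a i *: v (g i)) = \sum_(i | P i) a i *: F (g i).
Proof.
by rewrite linear_sum; apply: eq_bigr => i _; rewrite linearZ /= rVpoly_family.
Qed.

Lemma rVpoly_neq0 s : s != 0 -> rVpoly s != 0.
Proof. by apply: contraNneq => s0; rewrite -[s]rVpolyK s0 linear0. Qed.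

Lemma span_deg B s : s != 0 -> s \in span_of v B ->
  exists2 i, i \in B & ((size (rVpoly s)).-1 <= deg i)%N.
Proof.
move=> s0 /span_ofP[a def]; have [B0|[i0 i0B]] := set_0Vmem B.
  by move: s0; rewrite def B0 big_set0 eqxx.
pose m := [arg max_(i > i0 in B) deg i].
have [mB mmax] : m \in B /\ forall i, i \in B -> (deg i <= deg m)%N.
  by rewrite /m; case: arg_maxnP.
exists m => //; rewrite /deg -!subn1 leq_sub2r // def rVpoly_comb.
apply: leq_trans (size_sum _ _ _) _; apply/bigmax_leqP => i /mmax.
rewrite /deg -ltnS !prednK ?size_poly_gt0 //; apply: leq_trans.
exact: size_scale_leq.
Qed.

Lemma span_mup B s x k : s != 0 -> s \in span_of v B ->
  (forall i, i \in B -> (k <= w x i)%N) -> (k <= mup x (rVpoly s))%N.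
Proof.
move=> s0 /span_ofP[a def] kB; rewrite mup_geq ?rVpoly_neq0 // def rVpoly_comb.
apply: (big_ind (fun p => _ %| p)) => [|p q|i /kB]; first exact: dvdp0.
  exact: dvdp_add.
by rewrite mup_geq // -mul_polyC => /dvdp_mull ->.
Qed.

Lemma sum_w i : (\sum_(x <- Z) w x i = deg i)%N.
Proof. by have [_ ->] := sum_mup (F_neq0 i) uniqZ; rewrite // => x; apply: rootsZ. Qed.

(* [Bx x] is the basis used at the point [x], [Binf] the one at infinity, and [c x]
   stands for the multiplicity at [x] of a polynomial (the gcd of [M], or [F o])
   whose degree is lost in the final bound. *)
Definition weighted c M : Prop := exists (Bx : K -> {set I}) (Binf : {set I}),
  [/\ forall x, basis_in v M (Bx x), forall x, o \notin Bx x, basis_in v M Binf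
    & forall m, m \in M -> (\sum_(i in Binf) deg i + deg m <=
        \sum_(x <- Z) (\sum_(i in Bx x) w x i) + \sum_(x <- Z) c x)%N].

Lemma basis_ear M J s B j : ear v M J s -> basis_in v M B -> j \in J ->
  basis_in v (M :|: J) (B :|: J :\ j).
Proof.
move=> E [sBM spB cB] jJ; split.
- by rewrite setUSS ?subD1set.
- by rewrite span_ofU spB -span_ofU (ear_span E).
have dis : [disjoint B & J :\ j].
  apply: disjointWl sBM _; apply: disjointWr (subD1set _ _) (ear_disjoint E).
have := cardsD1 j J; rewrite jJ add1n => cJ.
have := ear_dim E; rewrite cJ -cB addnS => -[->].
by rewrite cardsU disjoint_setI0 // cards0 subn0.
Qed.

(** At [x] the element of [J] of least multiplicity is left out, at infinity the one of largest
    degree. The multiplicities lost are paid for by those of [s], which sum to at most its degree,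
    and that degree is bounded within [M] and within [J]. *)
Lemma weighted_ear c c' M J s : weighted c M -> ear v M J s -> o \notin J ->
  (forall x j, j \in J -> (forall i, i \in J -> (w x j <= w x i)%N) ->
     (c x + w x j <= c' x + mup x (rVpoly s))%N) ->
  weighted c' (M :|: J).
Proof.
move=> [Bx [Binf [BxP oBx BinfP ineq]]] E oJ cc'.
have s0 := ear_neq0 E.
have [m' m'M degM] := span_deg s0 (ear_meml E).
have [j' j'J degJ] := span_deg s0 (ear_memr E).
pose jmin x := [arg min_(i < j' in J) w x i].
have [jminJ jminP] : (forall x, jmin x \in J) /\
    (forall x i, i \in J -> (w x (jmin x) <= w x i)%N).
  by split=> x; rewrite /jmin; case: arg_minnP.
pose jmax := [arg max_(i > j' in J) deg i].
have [jmaxJ jmaxP] : jmax \in J /\ (forall i, i \in J -> (deg i <= deg jmax)%N).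
  by rewrite /jmax; case: arg_maxnP.
have disJ B (g : I -> nat) j : B \subset M -> j \in J ->
    (\sum_(i in B :|: J :\ j) g i + g j = \sum_(i in B) g i + \sum_(i in J) g i)%N.
  move=> BM jJ; rewrite [X in (_ = _ + X)%N](big_setD1 j) //= [(g j + _)%N]addnC addnA.
  congr (_ + _)%N; rewrite (eq_bigl (fun i => (i \in B) || (i \in J :\ j))) => [|i]; last by rewrite inE.
  rewrite -bigU //; apply: disjointWl BM _.
  exact: disjointWr (subD1set _ _) (ear_disjoint E).
exists (fun x => Bx x :|: J :\ jmin x), (Binf :|: J :\ jmax); split.
- by move=> x; apply: basis_ear E (BxP x) (jminJ x).
- by move=> x; rewrite !inE !negb_or oBx negb_and oJ orbT.
- exact: basis_ear E BinfP jmaxJ.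
move=> m mMJ.
have sumJ : (\sum_(x <- Z) \sum_(i in J) w x i = \sum_(i in J) deg i)%N.
  by rewrite exchange_big; apply: eq_bigr => i _; rewrite sum_w.
have sumx : (\sum_(x <- Z) \sum_(i in Bx x :|: J :\ jmin x) w x i +
    \sum_(x <- Z) w x (jmin x) = \sum_(x <- Z) \sum_(i in Bx x) w x i +
    \sum_(i in J) deg i)%N.
  rewrite -sumJ -!big_split; apply: eq_bigr => x _ /=; apply: disJ => //.
  by have [] := BxP x.
have sumc : (\sum_(x <- Z) c x + \sum_(x <- Z) w x (jmin x) <=
    \sum_(x <- Z) c' x + (size (rVpoly s)).-1)%N.
  have [les _] := sum_mup (rVpoly_neq0 s0) uniqZ.
  apply: leq_trans (leq_add (leqnn _) les); rewrite -!big_split.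
  by apply: leq_sum => x _; apply: cc' => //; apply: jminP.
have suminf := disJ Binf deg jmax (let: And3 h _ _ := BinfP in h) jmaxJ.
(* For [m] in [M] take [n = m] and bound the degree of [s] by [jmax]; for [m] in [J] bound it by
   [n = m']. *)
have ineq' : exists2 n, n \in M & (deg m + (size (rVpoly s)).-1 <= deg jmax + deg n)%N.
  move: mMJ; rewrite inE => /orP[mM|mJ].
    exists m => //; rewrite addnC leq_add2r (leq_trans degJ) ?jmaxP //.
  by exists m' => //; rewrite leq_add ?jmaxP.
have [n nM len] := ineq'; have := ineq n nM.
move: suminf sumx sumc len; clear.
set a := (\sum_(i in Binf :|: _) _)%N; set b := (\sum_(i in Binf) _)%N.
set d := (\sum_(i in J) _)%N; set e := (\sum_(x <- Z) w x _)%N.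
set f := (\sum_(x <- Z) \sum_(i in _ :|: _) _)%N.
set g := (\sum_(x <- Z) \sum_(i in Bx x) _)%N.
set h := (\sum_(x <- Z) c x)%N; set h' := (\sum_(x <- Z) c' x)%N.
move: (deg jmax) (deg n) (deg m) (size _).-1 => p q r t.
lia.
Qed.

(** When no ear is left, the sum over [M] is minus the sum over the rest of [T], so it lies in both
    spans and is 0. Otherwise a nonempty ear is added and the rest shrinks. *)
Lemma growth (P : {set I} -> Prop) M0 T :
  (forall M J s, P M -> M \subset T -> J \subset T :\: M -> ear v M J s -> P (M :|: J)) ->
  M0 \subset T -> P M0 -> \sum_(i in T) F i = 0 ->
  exists M, [/\ M0 \subset M, M \subset T, P M & \sum_(i in M) F i = 0].
Proof.
move=> step sM0T PM0 sumT.
suff: forall n M, (#|T :\: M| < n)%N -> M0 \subset M -> M \subset T -> P M ->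
    exists M, [/\ M0 \subset M, M \subset T, P M & \sum_(i in M) F i = 0].
  by move/(_ _ M0 (ltnSn _)); apply.
elim=> // n IHn M; rewrite ltnS => len sM0M sMT PM.
have [cap0|cap] := eqVneq (span_of v M :&: span_of v (T :\: M))%VS 0%VS.
  exists M; split=> //; pose u := \sum_(i in M) v i.
  have sumv : \sum_(i in T) v i = 0.
    by transitivity (poly_rV (\sum_(i in T) F i) : 'rV[K]_N);
      [rewrite linear_sum | rewrite sumT linear0].
  have uM : u \in (span_of v M :&: span_of v (T :\: M))%VS.
    rewrite memv_cap; apply/andP; split.
      by apply: rpred_sum => i iM; apply: span_of_mem.
    move: sumv; rewrite (big_setID M) /= (setIidPr sMT) => /eqP.
    rewrite addr_eq0 => /eqP uE; rewrite /u uE memvN.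
    by apply: rpred_sum => i iM; apply: span_of_mem.
  move: uM; rewrite cap0 memv0 => /eqP u0.
  have -> : \sum_(i in M) F i = rVpoly u.
    by rewrite /u linear_sum; apply: eq_bigr => i _; rewrite /= rVpoly_family.
  by rewrite u0 linear0.
have [J [s [sJ E]]] := ear_exists sMT cap.
apply: (IHn (M :|: J)) => //; last exact: step E.
- apply: leq_trans len; apply: proper_card; rewrite properE; apply/andP; split.
    by apply: setDS; apply: subsetUl.
  have [J0|[j jJ]] := set_0Vmem J.
    by have := ear_memr E; rewrite J0 /span_of big_set0 memv0 (negPf (ear_neq0 E)).
  apply/subsetPn; exists j; first exact: subsetP jJ.
  by rewrite !inE jJ orbT.
- by rewrite subsetU // sM0M.
- by rewrite subUset sMT (subset_trans sJ) // subsetDl.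
Qed.

Lemma wronskian_basis_neq0 M B e (sigma : 'I_e -> I) : basis_in v M B ->
  injective sigma -> B = [set sigma i | i in 'I_e] ->
  wronskian (F \o sigma) != 0.
Proof.
move=> BP inj defB; apply: wronskian_neq0 => a a0 i.
pose a' k := oapp a 0 [pick j | sigma j == k].
have a'E j : a' (sigma j) = a j.
  rewrite /a'; case: pickP => [l /eqP/inj -> //|/(_ j)].
  by rewrite eqxx.
rewrite -a'E; apply: (basis_independent BP); last by rewrite defB imset_f.
rewrite defB big_imset => [|k l _ _ /inj //] /=.
rewrite -[LHS]rVpolyK (rVpoly_comb (fun i => i \in 'I_e) (a' \o sigma) sigma) /=.
by under eq_bigr do rewrite a'E; rewrite a0 linear0.
Qed.

Lemma wronskian_basis_change M B B' e (sigma sigma' : 'I_e -> I) :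
  basis_in v M B -> basis_in v M B' -> injective sigma ->
  B = [set sigma i | i in 'I_e] -> B' = [set sigma' i | i in 'I_e] ->
  exists a, wronskian (F \o sigma') = a *: wronskian (F \o sigma).
Proof.
move=> [_ spB _] [_ spB' _] inj defB defB'.
have /fin_all_exists[A AP] : forall i, exists a : I -> K,
    v (sigma' i) = \sum_(k in B) a k *: v k.
  by move=> i; apply/span_ofP; rewrite spB -spB' span_of_mem // defB' imset_f.
exists (\det (\matrix_(i, j) A i (sigma j))).
apply: wronskian_change => i; rewrite /= -rVpoly_family AP defB.
rewrite big_imset => [|k l _ _ /inj //] /=.
rewrite (rVpoly_comb (fun i => i \in 'I_e) (A i \o sigma) sigma) /=.
by apply: eq_bigr => j _; rewrite mxE.
Qed.

(** The Wronskians of all the bases differ by nonzero constants, so one Wronskian has its order at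
    [x] bounded through [Bx x] and its degree through [Binf]. Roots of [F o] are not counted since
    [o] is in no [Bx x]. *)
Lemma weighted_bound c M m (e := \dim (span_of v M)) :
  weighted c M -> m \in M ->
  (deg m + \sum_(j < e) j <=
     \sum_(x <- Z) c x + e.-1 * \sum_(i | i != o) count (root (F i)) Z)%N.
Proof.
move=> [Bx [Binf [BxP oBx BinfP ineq]]] mM; have {ineq} := ineq m mM.
have [_ _ cinf] := BinfP; have [sigma inj defB] := enum_card cinf.
have W0 := wronskian_basis_neq0 BinfP inj defB.
have degW := size_wronskian W0.
have {degW} degW : ((size (wronskian (F \o sigma))).-1 + \sum_(j < e) j <=
    \sum_(i in Binf) deg i)%N.
  by rewrite defB big_imset => [|k l _ _ /inj //].
have local x : (\sum_(i in Bx x) w x i <=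
    mup x (wronskian (F \o sigma)) + e.-1 * \sum_(i in Bx x) root (F i) x)%N.
  have [_ _ cx] := BxP x; have [sigma' inj' defBx] := enum_card cx.
  have W'0 := wronskian_basis_neq0 (BxP x) inj' defBx.
  have [a aE] := wronskian_basis_change BinfP (BxP x) inj defB defBx.
  have a0 : a != 0 by apply: contraNneq W'0 => a0; rewrite aE a0 scale0r.
  have := wronskian_mup x W'0; rewrite aE -mul_polyC mupMr; last first.
    by rewrite rootE hornerC.
  by rewrite defBx !big_imset => [|k l _ _ /inj' //|k l _ _ /inj' //].
have sumW : (\sum_(x <- Z) \sum_(i in Bx x) w x i <= (size (wronskian (F \o sigma))).-1 +
    e.-1 * \sum_(i | i != o) count (root (F i)) Z)%N.
  have [les _] := sum_mup W0 uniqZ.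
  apply: leq_trans (leq_add les (leqnn _)).
  apply: leq_trans (leq_sum _ (fun x _ => local x)) _.
  rewrite big_split leq_add2l /= -big_distrr leq_mul2l /=; apply/orP; right.
  under [X in (_ <= X)%N]eq_bigr do rewrite -sum1_count big_mkcond.
  rewrite [X in (_ <= X)%N]exchange_big; apply: leq_sum => x _ /=.
  rewrite [X in (X <= _)%N]big_mkcond [X in (_ <= X)%N]big_mkcond.
  apply: leq_sum => i _; case: ifP => // iB.
  have -> : i != o by apply: contraTneq iB => ->; apply: oBx.
  by case: root.
move: degW sumW; clear; move: (size _).-1 => sW.
set a := (\sum_(x <- Z) \sum_(i in Bx x) _)%N; set b := (\sum_(i in Binf) _)%N.
set C := (\sum_(j < e) _)%N; set s := (_ * _)%N.
lia.
Qed.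

Let Wb := (\sum_(i | i != o) count (root (F i)) Z)%N.

Lemma family_vector_neq0 i : v i != 0.
Proof. by apply: contraNneq (F_neq0 i) => e; rewrite -rVpoly_family e linear0. Qed.

Lemma span_dim_bounds M m d (b : 'I_d -> {poly K}) : m \in M ->
  (forall i, exists a : 'I_d -> K, F i = \sum_j a j *: b j) ->
  (0 < \dim (span_of v M) <= d)%N.
Proof.
move=> mM Fb; apply/andP; split.
  rewrite lt0n dimv_eq0; apply: contra (family_vector_neq0 m) => /eqP s0.
  by rewrite -memv0 -s0 span_of_mem.
pose u j : 'rV[K]_N := poly_rV (b j).
apply: leq_trans (_ : \dim (span_of u [set: 'I_d]) <= _)%N; last first.
  by apply: leq_trans (dim_span_of _ _) _; rewrite cardsT card_ord.
apply: dimvS; apply/subv_sumP => i _; rewrite -memvE; have [a def] := Fb i.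
apply/span_ofP; exists a; rewrite /v def linear_sum.
by apply: eq_big => [j|j _]; rewrite ?inE ?linearZ.
Qed.

(** The first ear [J] attached to [o] is itself a basis of the span of both together and serves at
    every finite point; at infinity [o] replaces the element of [J] of largest degree. *)
Lemma circuit_weighted : \sum_i F i = 0 ->
  exists M, o \in M /\ weighted (fun x => w x o) M.
Proof.
move=> sumF; have sumv : \sum_i v i = 0.
  by transitivity (poly_rV (\sum_i F i) : 'rV[K]_N); [rewrite linear_sum | rewrite sumF linear0].
have v0 := family_vector_neq0.
have ovo : v o \in span_of v [set o] by rewrite span_of_mem ?set11.
have [||J [s [sJ E]]] := @ear_exists _ _ _ v [set o] setT; first exact: subsetT.
  apply: contraNneq (v0 o) => cap0; rewrite -memv0 -cap0 memv_cap ovo /=.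
  have /eqP := sumv; rewrite (bigD1 o) //= addr_eq0 => /eqP ->; rewrite memvN.
  by apply: rpred_sum => i io; rewrite span_of_mem // !inE io.
have dim1 : \dim (span_of v [set o]) = 1%N by rewrite /span_of big_set1 dim_vline v0.
have dimM : \dim (span_of v ([set o] :|: J)) = #|J|.
  by have := ear_dim E; rewrite dim1 add1n => -[].
have oJ : o \notin J by have := ear_disjoint E; rewrite disjoints1.
have spJ : span_of v J = span_of v ([set o] :|: J).
  by apply/eqP; rewrite eqEdim span_ofS ?subsetUr //= dimM (ear_free E).
have oinJ : v o \in span_of v J by rewrite spJ span_of_mem // !inE eqxx.
have [j' j'J degJ] := span_deg (v0 o) oinJ; rewrite rVpoly_family in degJ.
pose jmax := [arg max_(i > j' in J) deg i].
have [jmaxJ jmaxP] : jmax \in J /\ (forall i, i \in J -> (deg i <= deg jmax)%N).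
  by rewrite /jmax; case: arg_maxnP.
exists ([set o] :|: J); split; first by rewrite !inE eqxx.
have oP : basis_in v [set o] [set o] by split; rewrite ?cards1 ?dim1.
exists (fun=> J), ([set o] :|: J :\ jmax); split=> //.
- by move=> _; split; rewrite ?subsetUr.
- exact: basis_ear E oP jmaxJ.
move=> m mM; rewrite [X in (_ <= X + _)%N]exchange_big /=.
rewrite [X in (_ <= X + _)%N](eq_bigr deg) => [|i _]; last by rewrite sum_w.
rewrite sum_w big_setU1 /=; last by rewrite !inE (negPf oJ) andbF.
rewrite [X in (_ <= X + _)%N](big_setD1 jmax) //=.
have : (deg m <= deg jmax)%N.
  move: mM; rewrite !inE => /orP[/eqP->|/jmaxP //].
  exact: leq_trans degJ (jmaxP _ j'J).
rewrite -/(deg o); lia.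
Qed.

Theorem univariate_bound d (b : 'I_d -> {poly K}) m :
  \sum_i F i = 0 ->
  (forall i, exists a : 'I_d -> K, F i = \sum_j a j *: b j) ->
  (forall S, S != set0 -> \sum_(i in S) F i = 0 ->
     forall D, (forall i, i \in S -> D %| F i) -> (size D <= size (F o))%N) ->
  exists e, (0 < e <= d)%N /\
    (deg m + \sum_(j < e) j <= deg o + e.-1 * Wb)%N.
Proof.
move=> sumF Fb gcdF; have [M0 [oM0 M0w]] := circuit_weighted sumF.
have [||//|M [sM0M _ [oM Mw] sumM]] := @growth
    (fun M => o \in M /\ weighted (fun x => w x o) M) M0 setT _ (subsetT _).
- move=> M J s [oM Mw] _ sJ E; split; first by rewrite inE oM.
  have oJ : o \notin J by apply: contraTN oM => /(subsetP sJ); rewrite !inE andbT.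
  apply: (weighted_ear Mw E oJ) => x j jJ jmin; rewrite leq_add2l.
  exact: span_mup (ear_neq0 E) (ear_memr E) jmin.
- by split.
- by under eq_bigl do rewrite inE.
have [mM|mM] := boolP (m \in M).
  exists (\dim (span_of v M)); split; first exact: (span_dim_bounds mM Fb).
  by apply: leq_trans (weighted_bound Mw mM) _; rewrite sum_w.
(* Here [c] stays below all multiplicities in the growing family, so that it is the multiplicity
   function of a common divisor. *)
have [||||M' [mM' sM' [c [M'w cP]] sumM']] := @growth
    (fun M' => exists c, weighted c M' /\ forall x i, i \in M' -> (c x <= w x i)%N)
    [set m] (~: M).
- move=> A J s [c [Aw cP]] sA sJ E.
  have oJ : o \notin J.
    by apply: contraTN oM => /(subsetP sJ); rewrite !inE => /andP[].
  have [j0 j0J _] := span_deg (ear_neq0 E) (ear_memr E).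
  pose jmin x := [arg min_(i < j0 in J) w x i].
  have jminP x : jmin x \in J /\ forall i, i \in J -> (w x (jmin x) <= w x i)%N.
    by rewrite /jmin; case: arg_minnP.
  (* The order of [s] at [x] is at least the larger of the two numbers, and the minimum and the
     maximum have the same sum as the numbers. *)
  exists (fun x => minn (c x) (w x (jmin x))); split; last first.
    move=> x i; rewrite inE => /orP[/(cP x)|/(proj2 (jminP x))]; apply: leq_trans.
      exact: geq_minl.
    exact: geq_minr.
  apply: (weighted_ear Aw E oJ) => x j jJ jmn.
  have -> : w x (jmin x) = w x j.
    apply/eqP; rewrite eqn_leq (proj2 (jminP x)) // jmn //.
    by case: (jminP x).
  have := span_mup (ear_neq0 E) (ear_memr E) jmn.
  have := span_mup (ear_neq0 E) (ear_meml E) (fun i => cP x i).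
  lia.
- by rewrite sub1set inE.
- have v0 := family_vector_neq0.
  have mP : basis_in v [set m] [set m].
    by split; rewrite ?cards1 // /span_of big_set1 dim_vline v0.
  exists (w^~ m); split; last by move=> x i; rewrite inE => /eqP->.
  exists (fun=> [set m]), [set m]; split=> //.
    by move=> _; rewrite inE; apply: contraNneq mM => <-.
  move=> k; rewrite inE => /eqP->; rewrite big_set1.
  by under [X in (_ <= X + _)%N]eq_bigr do rewrite big_set1; rewrite !sum_w.
- have := sumF; rewrite (bigID (fun i => i \in M)) /= sumM add0r => sumC; rewrite -[RHS]sumC.
  by apply: eq_bigl => i; rewrite inE.
have mM'm : m \in M' by rewrite (subsetP mM') // set11.
exists (\dim (span_of v M')); split; first exact: (span_dim_bounds mM'm Fb).
apply: leq_trans (weighted_bound M'w mM'm) _; rewrite leq_add2r.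
pose D := \prod_(x <- Z) ('X - x%:P) ^+ c x.
have szD : size D = (\sum_(x <- Z) c x).+1 by apply: size_prod_XsubCX.
rewrite -[X in (X <= _)%N]/((\sum_(x <- Z) c x).+1.-1) -szD /deg -!subn1 leq_sub2r //.
apply: gcdF sumM' _ _ => [|i iM']; first by apply/set0Pn; exists m.
by apply: prod_XsubC_mup => // x _; apply: cP.
Qed.

End Univariate.

(** * The multivariate inequality *)

Section Degrees.
Variables (K : fieldType) (v : nat).
Implicit Types p q : {mpoly K[v]}.

Lemma tdegM p q : p != 0 -> q != 0 -> tdeg (p * q) = (tdeg p + tdeg q)%N.
Proof.
move=> p0 q0; rewrite /tdeg msizeM //.
move: p0 q0; rewrite -!msize_poly_eq0.
by case: (msize p) => // k _; case: (msize q) => // l _; rewrite addnS.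
Qed.

Lemma tdeg_eq0 p : p != 0 -> tdeg p = 0%N -> p \is a GRing.unit.
Proof.
move=> p0 deg0; have def : p = (p@_0)%:MP.
  by apply: msize1_polyC; move: deg0; rewrite /tdeg; case: (msize p) => [|[]].
by rewrite def mpolyC_unit; apply: contraNneq p0 => pe; rewrite def pe mpolyC0.
Qed.

Lemma tdeg_const p : is_const p = (tdeg p == 0%N).
Proof.
apply/eqP/eqP => [->|deg0]; last first.
  by apply: msize1_polyC; move: deg0; rewrite /tdeg; case: (msize p) => [|[]].
by rewrite /tdeg msizeC; case: eqP.
Qed.

Lemma rdeg_gt0 p : p != 0 -> ~~ is_const p -> (0 < rdeg p)%N.
Proof.
move=> p0; apply: contraR; rewrite -leqNgt leqn0 => /eqP deg0.
have [s [c [P [e [c0 [Pirr [_ [_ [def defr]]]]]]]]] := radicalP p0.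
have rU : radical p \is a GRing.unit.
  apply: tdeg_eq0 deg0; rewrite defr; apply/prodf_neq0 => i _.
  by case: (Pirr i).
have PU i : P i \is a GRing.unit by move: rU; rewrite defr => /unitr_prodP; apply.
have : p \is a GRing.unit.
  rewrite def -mul_mpolyC unitrM mpolyC_unit c0 /=.
  by apply/unitr_prodP => i _; rewrite unitrX.
by case/mpoly_unitE => d _ ->; rewrite tdeg_const /tdeg msizeC; case: (d != 0).
Qed.

(** A root of the restricted [p] is a root of some restricted irreducible factor, hence of the
    restricted radical, whose degree is at most [rdeg p]. *)
Lemma count_roots_rdeg (a b : 'I_v -> K) p (Z : seq K) :
  p != 0 -> line a b p != 0 -> uniq Z ->
  (count (root (line a b p)) Z <= rdeg p)%N.
Proof.
move=> p0 l0 uZ; have [s [c [P [e [c0 [_ [_ [e0 [def defr]]]]]]]]] := radicalP p0.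
have lE : line a b p = c *: \prod_i line a b (P i) ^+ e i.
  rewrite {1}def lineZ rmorph_prod; congr (_ *: _); apply: eq_bigr => i _.
  by rewrite rmorphXn.
have lrE : line a b (radical p) = \prod_i line a b (P i).
  by rewrite defr rmorph_prod.
have lP0 i : line a b (P i) != 0.
  move: l0; rewrite lE scaler_eq0 (negPf c0) /= => /prodf_neq0/(_ i isT).
  by rewrite expf_eq0 e0.
have lr0 : line a b (radical p) != 0.
  by rewrite lrE; apply/prodf_neq0 => i _; exact: lP0.
have := max_poly_roots (rs := [seq x <- Z | root (line a b p) x]) lr0 _ (filter_uniq _ uZ).
rewrite size_filter => H; rewrite -ltnS; apply: leq_trans (size_line_leq a b _); apply: H.
apply/allP => x; rewrite mem_filter => /andP[rx _]; move: rx.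
rewrite lE lrE rootZ // !rootE !horner_prod => /prodf_eq0[i _].
rewrite horner_exp expf_eq0 => /andP[_ Pix].
by apply/prodf_eq0; exists i.
Qed.

End Degrees.

Section LineReduction.
Variables (K : numClosedFieldType) (v n : nat) (f : 'I_n.+1 -> {mpoly K[v]}).
Local Notation o := (@ord_max n).
Hypothesis f_neq0 : forall i, f i != 0.
Hypothesis sum_f : \sum_i f i = 0.
Hypothesis deg_gcd : forall S : {set 'I_n.+1}, S != set0 -> \sum_(i in S) f i = 0 ->
  forall g, is_gcd f S g -> (tdeg g <= tdeg (f o))%N.
Variable d : nat.
Hypothesis dim_span : span_dim f d.

Let factA : factorial_ring {mpoly K[v]} := @factorial_mpoly K v.

(** Bezout for the cofactors of the gcd [gS] of the [h i] on [S]: where [r] does not vanish, common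
    divisors of the restrictions divide the restriction of [gS]. *)
Lemma gcd_line_bound (g : {mpoly K[v]}) (h : 'I_n.+1 -> {mpoly K[v]}) b :
  g != 0 -> (forall i, h i != 0) -> (forall i, f i = g * h i) ->
  forall S : {set 'I_n.+1}, exists2 r : {mpoly K[v]}, r != 0 &
    S != set0 -> forall a, r.@[a] != 0 -> exists2 gS, is_gcd f S (g * gS) &
      forall D, (forall i, i \in S -> D %| line a b (h i)) -> D %| line a b gS.
Proof.
move=> g0 h0 fE S; have [->|/set0Pn[i0 i0S]] := eqVneq S set0.
  by exists 1; rewrite ?oner_neq0 // eqxx.
have [|gS [k [gS0 hE kgcd]]] := gcd_decomposition factA (f := h) (S := S).
  by exists i0.
have [|r r0 bez] := @Bezout_line K v _ k S b _ kgcd.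
  by exists i0 => //; apply: contraNneq (h0 i0) => e; rewrite hE // e mulr0.
exists r => // _ a ra; exists gS.
  apply: (is_gcd_mul factA _ _ kgcd); first by rewrite mulf_neq0.
  by move=> i iS; rewrite fE hE // mulrA.
move=> D dvdD; have [U UE] := bez a.
rewrite -(dvdpZr _ _ ra) -mul_polyC -UE big_distrl /=.
apply: (big_ind (fun p => D %| p)) => [|p q|i iS]; first exact: dvdp0.
  exact: dvdp_add.
by rewrite -mulrA dvdp_mull // mulrC -rmorphM -hE // dvdD.
Qed.

Lemma multivariate_bound : exists g, is_gcd f [set: 'I_n.+1] g /\
  forall m, exists e s,
    [/\ (0 < e <= d)%N, (tdeg (f m) + \sum_(j < e) j <= tdeg (f o) + e.-1 * s)%N
      & (s + (0 < tdeg g) <= \sum_(i | i != o) rdeg (f i))%N].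
Proof.
have [|g [h [g0 fE' hgcd]]] := gcd_decomposition factA (f := f) (S := [set: 'I_n.+1]).
  by exists o; rewrite ?inE.
have {fE'} fE i : f i = g * h i by rewrite fE' ?inE.
have h0 i : h i != 0 by apply: contraNneq (f_neq0 i) => e; rewrite fE e mulr0.
exists g; split; first by apply: (is_gcd_mul factA g0 _ hgcd) => i _.
have tfE i : tdeg (f i) = (tdeg g + tdeg (h i))%N by rewrite fE tdegM.
(* A direction that keeps the degrees of [g] (the case [None]) and of all [h i]. *)
have [b bP] : exists b, forall j : option 'I_n.+1, true ->
    (top_form (oapp h g j)).@[b] != 0.
  apply: common_nonroot => j _; apply: top_form_neq0.
  by case: j => [i|] /=.
have topg : (top_form g).@[b] != 0 by apply: (bP None).
have toph i : (top_form (h i)).@[b] != 0 by apply: (bP (Some i)).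
have [r0 r00 bez] := Bezout_line b (ex_intro2 _ _ o (in_setT o) (h0 o)) hgcd.
have /fin_all_exists2[r rN0 rP] := gcd_line_bound b g0 h0 fE.
(* The base point avoids the zeros of all the Bezout constants and of all nonzero subsums of the
   [h i]. *)
have [a aP] : exists a, forall j : {set 'I_n.+1}, true ->
    (r0 * (r j * (if \sum_(i in j) h i == 0 then 1 else \sum_(i in j) h i))).@[a] != 0.
  apply: common_nonroot => S _; rewrite !mulf_neq0 ?r00 ?rN0 //.
  by case: ifP => [_|/negbT //]; rewrite oner_neq0.
have r0a : r0.@[a] != 0.
  by have := aP set0 isT; rewrite mevalM mulf_eq0 => /norP[].
have ra S : (r S).@[a] != 0.
  by have := aP S isT; rewrite !mevalM !mulf_eq0 => /norP[_ /norP[]].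
have suma (S : {set 'I_n.+1}) : (\sum_(i in S) h i).@[a] = 0 -> \sum_(i in S) h i = 0.
  have := aP S isT; case: ifP => [/eqP //|_]; rewrite !mevalM !mulf_eq0.
  by case/norP=> _ /norP[_ /negPf ne] /eqP; rewrite ne.
have [L [szL leL L0 LZ [Lcount bezL rL]]] : exists L : {rmorphism {mpoly K[v]} -> {poly K}},
    [/\ forall p, (top_form p).@[b] != 0 -> size (L p) = (tdeg p).+1,
      forall p, (size (L p) <= (tdeg p).+1)%N, forall p, (L p).[0] = p.@[a],
      forall c p, L (c *: p) = c *: L p
    & [/\ forall p Z, p != 0 -> L p != 0 -> uniq Z -> (count (root (L p)) Z <= rdeg p)%N,
        exists U, \sum_(i in [set: 'I_n.+1]) U i * L (h i) = (r0.@[a])%:P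
      & forall S : {set 'I_n.+1}, S != set0 -> exists2 gS, is_gcd f S (g * gS) &
          forall D, (forall i, i \in S -> D %| L (h i)) -> D %| L gS]].
  exists (line a b); split.
  - exact: size_line.
  - exact: size_line_leq.
  - exact: line_at0.
  - exact: lineZ.
  - split=> [||S S0]; [exact: count_roots_rdeg | exact: bez |].
    exact: (rP S S0 a (ra S)).
pose H i := L (h i).
have szH i : size (H i) = (tdeg (h i)).+1 by apply: szL.
have szG : size (L g) = (tdeg g).+1 by apply: szL.
have H0 i : H i != 0 by rewrite -size_poly_gt0 szH.
have G0 : L g != 0 by rewrite -size_poly_gt0 szG.
have lfE i : L (f i) = L g * H i by rewrite fE rmorphM.
have P0 : L g * \prod_i H i != 0.
  by apply: (mulf_neq0 G0); apply/prodf_neq0 => i _; apply: H0.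
have [t tE] := closed_field_poly_normal (L g * \prod_i H i).
pose Z := undup t.
have memZ x : root (L g * \prod_i H i) x -> x \in Z.
  by rewrite tE rootZ ?lead_coef_eq0 // root_prod_XsubC mem_undup.
have rootHZ i x : root (H i) x -> x \in Z.
  by move=> Hx; apply: memZ; rewrite (bigD1 i) //= !rootM Hx orbT.
have sumH (S : {set 'I_n.+1}) : \sum_(i in S) H i = L (\sum_(i in S) h i) by rewrite rmorph_sum.
have sumfh (S : {set 'I_n.+1}) : \sum_(i in S) f i = g * \sum_(i in S) h i.
  by rewrite big_distrr; apply: eq_bigr => i _; rewrite fE.
have gcdH (S : {set 'I_n.+1}) : S != set0 -> \sum_(i in S) H i = 0 ->
    forall D, (forall i, i \in S -> D %| H i) -> (size D <= size (H o))%N.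
  (* A subsum that vanishes on the line vanishes at [a], hence identically, so the hypothesis on
     gcds applies to [S]. *)
  move=> S0 SH D dvdD; have hS : \sum_(i in S) h i = 0.
    by apply: suma; rewrite -(L0) -sumH SH horner0.
  have [gS gSgcd /(_ D dvdD) DgS] := rL S S0.
  have := deg_gcd S0 (_ : \sum_(i in S) f i = 0) gSgcd.
  rewrite sumfh hS mulr0 => /(_ erefl).
  have [i0 i0S] := set0Pn _ S0; have [c cE] := proj1 gSgcd i0 i0S.
  have gS0 : gS != 0.
    by apply: contraNneq (f_neq0 i0) => e; rewrite cE e !mulr0.
  rewrite tdegM // tfE leq_add2l szH => le.
  have lgS0 : L gS != 0.
    have : L (f i0) != 0 by rewrite lfE mulf_neq0.
    by apply: contraNneq => e; rewrite cE !rmorphM /= e !mulr0.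
  apply: leq_trans (dvdp_leq lgS0 DgS) _; apply: leq_trans (leL gS) _.
  by rewrite ltnS.
have [bb [bbf _ fbb]] := dim_span.
have /fin_all_exists[C CE] := bbf.
(* A spanning family for the [h i] is obtained by dividing the basis by [g]: its elements are
   combinations of the [f l = g * h l]. *)
have spanH i : exists c : 'I_d -> K, H i =
    \sum_j c j *: L (\sum_l C j l *: h l).
  have [c cE] := fbb i; exists c; rewrite /H.
  have -> : h i = \sum_j c j *: \sum_l C j l *: h l.
    apply: (mulfI g0); rewrite -fE cE big_distrr; apply: eq_bigr => j _ /=.
    rewrite -scalerAr CE big_distrr; congr (_ *: _); apply: eq_bigr => l _ /=.
    by rewrite fE scalerAr.
  by rewrite rmorph_sum; apply: eq_bigr => j _; rewrite /= LZ.
move=> m.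
have sumH0 : \sum_i H i = 0.
  have : g * \sum_i h i = 0.
    by rewrite -[RHS]sum_f big_distrr; apply: eq_bigr => i _; rewrite fE.
  by move/eqP; rewrite mulf_eq0 (negPf g0) => /eqP hs; rewrite -[RHS](rmorph0 L) -[in RHS]hs [RHS]rmorph_sum.
have [e [e_d ineq]] := univariate_bound (o := o) H0 (undup_uniq t) rootHZ m sumH0 spanH gcdH.
exists e, (\sum_(i | i != o) count (root (H i)) Z)%N; split=> //.
  by move: ineq; rewrite !szH !tfE /= -!addnA leq_add2l.
have cf i : (count (root (L (f i))) Z <= rdeg (f i))%N.
  by apply: Lcount; rewrite ?undup_uniq // lfE mulf_neq0.
have cH i : (count (root (H i)) Z <= count (root (L (f i))) Z)%N.
  by apply: sub_count => x Hx; rewrite lfE rootM Hx orbT.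
apply: leq_trans (leq_sum _ (fun i _ => cf i)).
have [_|tg] := posnP (tdeg g).
  by rewrite addn0; apply: leq_sum.
have [x Gx] : exists x, root (L g) x.
  by apply/closed_rootP; rewrite szG eqSS -lt0n.
have xZ : x \in Z by apply: memZ; rewrite rootM Gx.
(* If all [H i] with [i != o] vanished at [x], so would [H o] because the sum is 0, against the
   Bezout relation. *)
have [i io nHix] : exists2 i, i != o & ~~ root (H i) x.
  apply: NNPP => nex; have rootH i : i != o -> (H i).[x] = 0.
    move=> io; apply/eqP; apply: contraT => Hix; case: nex.
    by exists i; rewrite ?rootE.
  have rootHall i : (H i).[x] = 0.
    have [->|/rootH //] := eqVneq i o.
    have := congr1 (horner_eval x) sumH0; rewrite /horner_eval horner0 horner_sum.
    by rewrite (bigD1 o) //= [X in _ + X]big1 // addr0.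
  have [U UE] := bezL; have := congr1 (horner_eval x) UE.
  rewrite /horner_eval hornerC horner_sum big1 => [/esym/eqP|j _].
    by rewrite (negPf r0a).
  by rewrite hornerM rootHall mulr0.
(* At this [i] the point [x] is a root of the restricted [f i] but not of [H i], which gains one. *)
rewrite (bigD1 i) //= [X in (_ <= X)%N](bigD1 i) //= addnAC leq_add ?leq_sum //.
have := count_uniq_mem x (undup_uniq t); rewrite -/Z xZ /= => cntx.
rewrite -[X in (_ + X <= _)%N]cntx.
rewrite -count_predUI (@eq_count _ (predI _ _) pred0) => [|y /=]; last first.
  by apply/andP => -[Hy /eqP ye]; rewrite -ye Hy in nHix.
rewrite count_pred0 addn0; apply: sub_count => y /=.
by rewrite lfE rootM => /orP[->|/eqP->]; rewrite ?orbT ?Gx.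
Qed.

End LineReduction.

(** * From the dimension found to [d'] *)

Lemma sum_ord_double e : (2 * \sum_(j < e) j = e * e.-1)%N.
Proof.
elim: e => [|e IHe]; first by rewrite big_ord0.
by rewrite big_ord_recr /= mulnDr IHe; case: e {IHe} => // e; lia.
Qed.

(** [2 p s - p (p + 1)] grows by [2 (s - p - 1)] from [p] to [p + 1]. With [p = d' - 1] it is twice
    the right-hand side of the theorem. *)
Lemma factor_count_increasing (q p s : nat) : (q <= p)%N -> (p <= s)%N ->
  (2 * q * s + p * p.+1 <= 2 * p * s + q * q.+1)%N.
Proof. by move=> /subnKC <-; move: (p - q)%N => r le; nia. Qed.

Section MainTheorem.
Variables (K : numClosedFieldType) (v n : nat) (f : 'I_n.+1 -> {mpoly K[v]}).
Local Notation o := (@ord_max n).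
Hypothesis f_neq0 : forall i, f i != 0.
Hypothesis not_all_similar : ~ (forall i j, poly_similar (f i) (f j)).
Hypothesis sum_f : \sum_i f i = 0.

Lemma n_gt1 : (1 < n)%N.
Proof.
case: n f f_neq0 sum_f not_all_similar => [|[|//]] f' f'0 sum0 nsim.
  by move: sum0; rewrite big_ord_recl big_ord0 addr0 => /eqP; rewrite (negPf (f'0 _)).
case: nsim => i j; have [->|ne] := eqVneq i j; first by exists 1; rewrite ?oner_neq0 ?scale1r.
exists (-1); rewrite ?oppr_eq0 ?oner_neq0 // scaleN1r; apply/eqP.
rewrite -addr_eq0 -sum0 (bigD1 j) //= (bigD1 i) //= big1 ?addr0 // => l.
move: ne (ltn_ord l) (ltn_ord i) (ltn_ord j); rewrite -!val_eqE /=; lia.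
Qed.

Variable d : nat.
Hypothesis dim_span : span_dim f d.

Lemma d_gt1 : (1 < d)%N.
Proof.
rewrite ltnNge; apply/negP => d1; apply: not_all_similar => i j.
have [b [_ _ fb]] := dim_span.
have [ai ei] := fb i; have [aj ej] := fb j.
case: d d1 b ai aj ei ej {fb} => [|[|//]] _ b ai aj; rewrite ?big_ord0 ?big_ord1.
  by move=> ei; have := f_neq0 i; rewrite ei eqxx.
move=> ei ej; have ai0 : ai ord0 != 0.
  by apply: contraNneq (f_neq0 i) => e; rewrite ei e scale0r.
have aj0 : aj ord0 != 0.
  by apply: contraNneq (f_neq0 j) => e; rewrite ej e scale0r.
exists (aj ord0 / ai ord0); first by rewrite mulf_neq0 ?invr_eq0.
by rewrite ei ej scalerA divfK.
Qed.

Hypothesis deg_gcd : forall S : {set 'I_n.+1}, S != set0 -> \sum_(i in S) f i = 0 ->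
  forall g, is_gcd f S g -> (tdeg g <= tdeg (f o))%N.
Variable d' : nat.
Hypothesis le_dd' : (d <= d')%N.
Hypothesis le_d'n : (d' + #|[set i | is_const (f i)]| <= n.+1)%N.

Let S := (\sum_(i | i != o) rdeg (f i))%N.

(** At least [d'] of the [f i] are nonconstant, and each of them other than [f o] contributes at
    least 1 to [S]. *)
Lemma nonconst_leq_radicals : (d' <= S.+1)%N.
Proof.
have le : (#|[set i | ~~ is_const (f i)] :\ o| <= S)%N.
  rewrite -sum1_card /S [X in (_ <= X)%N](bigID (fun i => is_const (f i))) /=.
  rewrite -[X in (X <= _)%N]add0n leq_add //.
  rewrite (eq_bigl (fun i => (i != o) && ~~ is_const (f i))) => [|i]; last by rewrite !inE.
  by apply: leq_sum => i /andP[_ nc]; exact: (rdeg_gt0 (f_neq0 i) nc).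
have cE : (#|[set i | is_const (f i)]| + #|[set i | ~~ is_const (f i)]| = n.+1)%N.
  rewrite -[RHS]card_ord -(cardsC [set i | is_const (f i)]); congr (_ + _)%N.
  by apply: eq_card => i; rewrite !inE.
have := cardsD1 o [set i | ~~ is_const (f i)]; have := leq_b1 (o \in [set i | ~~ is_const (f i)]).
lia.
Qed.

(** Everything is doubled to stay in the naturals; the term [(0 < tdeg g)] carries the
    strictness. *)
Theorem multivariate_nat_bound m : exists g, is_gcd f [set: 'I_n.+1] g /\
  (2 * tdeg (f m) + d' * d'.-1 + (0 < tdeg g) <= 2 * tdeg (f o) + 2 * d'.-1 * S)%N.
Proof.
have [g [gP bound]] := multivariate_bound f_neq0 sum_f deg_gcd dim_span.
exists g; split=> //; have [e [s [/andP[e0 ed] ineq sS]]] := bound m.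
have := sum_ord_double e; have := d_gt1; have := nonconst_leq_radicals; have := n_gt1.
rewrite -/S in sS; move=> n1 d'S d1 e2.
case: e e0 ed ineq e2 => // q _ qd; rewrite /= => ineq e2.
case: d' d'S le_dd' le_d'n => [|p]; first by lia.
rewrite ltnS /= => pS dp pn.
have inc := factor_count_increasing (_ : (q <= p)%N) pS.
have {inc} inc := inc ltac:(lia).
have [tg|tg] := posnP (tdeg g).
  rewrite tg /= in sS *; nia.
(* A nonconstant gcd makes every [f i] nonconstant. This bound settles [e = 1], where the saved root
   has factor 0 and strictness must come from passing to [d']. *)
have nS : (n <= S)%N.
  rewrite /S -[X in (X <= _)%N](_ : #|[set~ o]| = n); last first.
    by rewrite cardsC1 card_ord.
  rewrite -sum1_card (eq_bigl (fun i => i != o)) => [|i]; last by rewrite !inE.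
  apply: leq_sum => i _; apply: rdeg_gt0 => //; rewrite tdeg_const.
  have [c cE] := proj1 gP i (in_setT i).
  have c0 : c != 0 by apply: contraNneq (f_neq0 i) => e; rewrite cE e mul0r.
  have g0 : g != 0 by apply: contraNneq (f_neq0 i) => e; rewrite cE e mulr0.
  by rewrite cE tdegM // -lt0n addn_gt0 tg orbT.
rewrite tg in sS *.
case: q qd ineq e2 inc => [|q] qd ineq e2 inc; last by nia.
by rewrite mul0n in ineq; nia.
Qed.

End MainTheorem.

Theorem theorem4p1 (R : realType) (v n : nat)
    (f : 'I_n.+1 -> {mpoly R[i][v]})
    (f_neq0 : forall i, f i != 0)
    (not_all_similar : ~ (forall i j, poly_similar (f i) (f j)))
    (sum_f : \sum_i f i = 0)
    (deg_gcd : forall S : {set 'I_n.+1}, S != set0 -> \sum_(i in S) f i = 0 ->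
       forall g, is_gcd f S g -> (tdeg g <= tdeg (f ord_max))%N)
    (d : nat) (dim_span : span_dim f d)
    (k : nat) (num_const : k = #|[set i | is_const (f i)]|)
    (d' : nat) (le_dd' : (d <= d')%N) (le_d'nk : (d' + k <= n.+1)%N) :
  let lhs : rat :=
    (\max_(i < n.+1 | i != ord_max) tdeg (f i))%N%:R - (tdeg (f ord_max))%:R in
  let rhs : rat :=
    (d'%:R - 1) *
      (\sum_(i < n.+1 | i != ord_max) (rdeg (f i))%:R - d'%:R / 2) in
  lhs <= rhs /\ (lhs = rhs -> is_gcd f [set: 'I_n.+1] 1).
Proof.
rewrite num_const in le_d'nk => lhs rhs.
have n1 := n_gt1 f_neq0 not_all_similar sum_f.
have o0 : ord0 != ord_max :> 'I_n.+1 by rewrite -val_eqE /= neq_ltn (ltnW n1).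
have card_gt0 : (0 < #|[pred i : 'I_n.+1 | i != ord_max]|)%N.
  by apply/card_gt0P; exists ord0; rewrite inE.
have [m mo maxE] := eq_bigmax_cond (fun i => tdeg (f i)) card_gt0.
have [g [gP bound]] := multivariate_nat_bound f_neq0 not_all_similar sum_f
  dim_span deg_gcd le_dd' le_d'nk m.
have d1 := d_gt1 f_neq0 not_all_similar dim_span.
have lhsE : lhs = (tdeg (f m))%:R - (tdeg (f ord_max))%:R by rewrite /lhs maxE.
have rhsE : rhs = (d'%:R - 1) * ((\sum_(i | i != ord_max) rdeg (f i))%N%:R - d'%:R / 2).
  by rewrite /rhs natr_sum.
have bound' : 2 * lhs + (0 < tdeg g)%N%:R <= 2 * rhs :> rat.
  rewrite lhsE rhsE; move: bound; move: (\sum_(_ | _) _)%N => s.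
  case: d' le_dd' {lhs rhs lhsE rhsE le_d'nk} => [|p _ /=]; first by lia.
  rewrite -(ler_nat rat) !natrD !natrM -[p.+1%:R]natr1; lra.
split; first by move: bound'; have := ler0n rat (0 < tdeg g)%N; lra.
(* Equality forces the extra term to be 0, so [g] is a unit and 1 is a gcd as well. *)
move=> eq_lr; have tg : tdeg g = 0%N.
  by move: bound'; rewrite eq_lr; case: (tdeg g) => // t; rewrite gerDl ler10.
have g0 : g != 0.
  have [c cE] := proj1 gP ord0 (in_setT _).
  by apply: contraNneq (f_neq0 ord0) => e; rewrite cE e mulr0.
have gU := tdeg_eq0 g0 tg.
split=> [i _|h hf]; first by exists (f i); rewrite mulr1.
have [c cE] := proj2 gP h hf.
by exists (g^-1 * c); rewrite -mulrA -cE mulVr.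
Qed.
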